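(* Fix integers $k\ge 2$ and $\delta$ with $k\le\delta\le 2k-1$, and set $h=\delta-k$. There exists an integer $n_{\mathrm{int}}(k,\delta)\ge 2\delta+2$ such that for every integer $n\ge n_{\mathrm{int}}(k,\delta)$ there is a graph $G^\star_{h,k,n}\in\mathcal{L}_{\mathcal{H}}^{2}(n,k,\delta)$, with the structure described below, such that every $G\in\mathcal{L}_{\mathcal{H}}^{2}(n,k,\delta)$ satisfies $$\rho(G)\le\rho\bigl(G^\star_{h,k,n}\bigr),$$ with equality if and only if $G\cong G^\star_{h,k,n}$. Consequently $G^\star_{h,k,n}$ is the unique maximizer of $\rho$ over $\mathcal{L}_{\mathcal{H}}^{2}(n,k,\delta)$ up to isomorphism. Its structure is as follows. (i) If $h=0$, then $\mathcal{L}_{\mathcal{H}}^{2}(n,k,\delta)$ consists of a single isomorphism class, represented by $G^\star_{0,k,n}$. (ii) If $h=1$, then the missing-edge graph $M^\star$ of $G^\star_{1,k,n}$ has a unique edge $uv$ and, after relabeling the vertices of $Y$, $N_Y(u)=N_Y(v)=\{y_1\}$. (iii) If $h\ge 2$, then the missing-edge graph of $G^\star_{h,k,n}$ is $M^\star\cong K_{1,h}\cup(h+1)K_1$. Let $c$ be the center of the $K_{1,h}$ component and $\ell_1,\dots,\ell_h$ its leaves. After relabeling the vertices of $Y$, $N_Y(c)=\{y_1,\dots,y_h\}$ (with $y_1,\dots,y_h$ distinct) and $N_Y(\ell_i)=\{y_1\}$ for $1\le i\le h$.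
   Context: All graphs are finite, simple and undirected; $\rho(G)$ denotes the adjacency spectral radius of $G$. Write $h=\delta-k$, so $0\le h\le k-1$. Family $\mathcal{L}_{\mathcal{H}}^{2}(n,k,\delta)$: it consists of all graphs $G$ (up to isomorphism) obtained as follows. Take pairwise disjoint vertex sets $X,W,Y$ with $|X|=2h+2$, $|W|=k-h-1$, $|Y|=n-k-h-1$. Choose a connected graph $H$ with vertex set $X$ and exactly $\binom{2h+2}{2}-h$ edges. Start from the graph $K_W\vee(H\cup K_Y)$, where $K_W,K_Y$ are the complete graphs on $W,Y$ ($K_\varnothing$ is the empty graph), $\cup$ is disjoint union and $\vee$ is the graph join. Then add a set $B$ of exactly $2h$ edges, each joining a vertex of $X$ to a vertex of $Y$, in such a way that every vertex of $X$ has degree at least $\delta$ in the resulting graph $G$. For a graph so constructed, its missing-edge graph $M$ is the graph on vertex set $X$ whose edges are the pairs of vertices of $X$ that are nonadjacent in $H$, i.e. $E(M)=E(K_X)\setminus E(H)$. For $x\in X$, $N_Y(x)$ denotes the set of neighbors of $x$ in $Y$. $K_{1,h}\cup(h+1)K_1$ denotes the disjoint union of a star with $h$ edges and $h+1$ isolated vertices. *)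

(* Defs.v *)
From mathcomp Require Import all_boot all_order all_algebra.
From mathcomp Require Import classical_sets reals.
From mathcomp Require Import complex.

Set Implicit Arguments.
Unset Strict Implicit.
Unset Printing Implicit Defensive.

Import Order.TTheory GRing.Theory Num.Theory.

Record sgraph (T : finType) := SGraph {
  adj :> rel T;
  adj_sym : symmetric adj;
  adj_irr : irreflexive adj }.

Section Graphs.

Definition giso (T1 T2 : finType) (G1 : sgraph T1) (G2 : sgraph T2)
    (f : T1 -> T2) : Prop :=
  bijective f /\ forall x y, G2 (f x) (f y) = G1 x y.

Definition isomorphic (T1 T2 : finType) (G1 : sgraph T1) (G2 : sgraph T2) :
    Prop :=
  exists f : T1 -> T2, giso G1 G2 f.

Definition edges (T : finType) (G : sgraph T) : {set {set T}} :=
  [set [set p.1; p.2] | p : T * T & G p.1 p.2].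

Definition deg (T : finType) (G : sgraph T) (x : T) : nat :=
  #|[set y | G x y]|.

(* Only used on the nonempty vertex set 'I_(2 * h + 2). *)
Definition gconnected (T : finType) (G : sgraph T) : Prop :=
  forall x y : T, connect G x y.

Lemma complete_sym (T : finType) : symmetric (fun x y : T => x != y).
Proof. by move=> x y; rewrite eq_sym. Qed.

Lemma complete_irr (T : finType) : irreflexive (fun x y : T => x != y).
Proof. by move=> x; rewrite eqxx. Qed.

Definition complete (T : finType) : sgraph T :=
  SGraph (@complete_sym T) (@complete_irr T).

Definition edgeless (T : finType) : sgraph T :=
  @SGraph T (fun _ _ => false) (fun _ _ => erefl) (fun _ => erefl).

Definition compl_adj (T : finType) (G : sgraph T) : rel T :=
  fun x y => (x != y) && ~~ G x y.

Lemma compl_sym (T : finType) (G : sgraph T) : symmetric (compl_adj G).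
Proof. by move=> x y; rewrite /compl_adj eq_sym adj_sym. Qed.

Lemma compl_irr (T : finType) (G : sgraph T) : irreflexive (compl_adj G).
Proof. by move=> x; rewrite /compl_adj eqxx. Qed.

Definition gcompl (T : finType) (G : sgraph T) : sgraph T :=
  SGraph (compl_sym G) (compl_irr G).

Definition sum_adj (b : bool) (T1 T2 : finType)
    (G1 : sgraph T1) (G2 : sgraph T2) : rel (T1 + T2) :=
  fun u v => match u, v with
             | inl x, inl y => G1 x y
             | inr x, inr y => G2 x y
             | _, _ => b
             end.

Lemma sum_sym b (T1 T2 : finType) (G1 : sgraph T1) (G2 : sgraph T2) :
  symmetric (sum_adj b G1 G2).
Proof. by move=> [x|x] [y|y] //=; rewrite adj_sym. Qed.

Lemma sum_irr b (T1 T2 : finType) (G1 : sgraph T1) (G2 : sgraph T2) :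
  irreflexive (sum_adj b G1 G2).
Proof. by move=> [x|x] /=; rewrite adj_irr. Qed.

Definition gunion (T1 T2 : finType) (G1 : sgraph T1) (G2 : sgraph T2) :
    sgraph (T1 + T2)%type :=
  SGraph (@sum_sym false T1 T2 G1 G2) (@sum_irr false T1 T2 G1 G2).

Definition gjoin (T1 T2 : finType) (G1 : sgraph T1) (G2 : sgraph T2) :
    sgraph (T1 + T2)%type :=
  SGraph (@sum_sym true T1 T2 G1 G2) (@sum_irr true T1 T2 G1 G2).

(* K_{1,h}; the center is [inl ord0] and the leaves are the [inr i]. *)
Definition star (h : nat) : sgraph ('I_1 + 'I_h)%type :=
  gjoin (edgeless 'I_1) (edgeless 'I_h).

End Graphs.

Section SpectralRadius.
Variable R : realType.
Local Open Scope ring_scope.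
Local Open Scope classical_set_scope.
Local Open Scope complex_scope.

Definition adjmx (T : finType) (G : sgraph T) : 'M[R[i]]_#|T| :=
  \matrix_(i, j) (G (enum_val i) (enum_val j))%:R.

(* Maximum modulus of the complex eigenvalues; the set is finite, and nonempty
   as soon as T is, so that the supremum is a maximum. *)
Definition rho (T : finType) (G : sgraph T) : R :=
  sup [set complex.Re `|z| | z in [set z : R[i] | eigenvalue (adjmx G) z]].

End SpectralRadius.

Section Family.
Variables W X Y : finType.

Definition B_adj (B : {set X * Y}) : rel (W + (X + Y)) :=
  fun u v => match u, v with
             | inr (inl x), inr (inr y) => (x, y) \in B
             | inr (inr y), inr (inl x) => (x, y) \in B
             | _, _ => false
             end.

Definition L_adj (H : sgraph X) (B : {set X * Y}) : rel (W + (X + Y)) :=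
  fun u v =>
    gjoin (complete W) (gunion H (complete Y)) u v || B_adj B u v.

Lemma L_sym H B : symmetric (L_adj H B).
Proof.
move=> u v; rewrite /L_adj adj_sym; congr (_ || _).
by case: u v => [w|[x|y]] [w'|[x'|y']].
Qed.

Lemma L_irr H B : irreflexive (L_adj H B).
Proof. by move=> u; rewrite /L_adj adj_irr; case: u => [w|[x|y]]. Qed.

Definition L_graph (H : sgraph X) (B : {set X * Y}) :
    sgraph (W + (X + Y))%type :=
  SGraph (L_sym H B) (L_irr H B).

Definition N_Y (H : sgraph X) (B : {set X * Y}) (x : X) : {set Y} :=
  [set y | L_graph H B (inr (inl x)) (inr (inr y))].

End Family.

Arguments L_graph W {X Y} H B.
Arguments N_Y W {X Y} H B x.

Local Open Scope nat_scope.

Definition Wtype (k h : nat) : finType := 'I_(k - h - 1).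
Definition Xtype (h : nat) : finType := 'I_(2 * h + 2).
Definition Ytype (n k h : nat) : finType := 'I_(n - k - h - 1).

(* The pairs (H, B) from which the family is built.  An edge between X and Y is
   encoded by the corresponding pair in X * Y. *)
Definition L_data (n k delta : nat) (H : sgraph (Xtype (delta - k)))
    (B : {set Xtype (delta - k) * Ytype n k (delta - k)}) : Prop :=
  let h := delta - k in
  [/\ gconnected H,
      #|edges H| = 'C(2 * h + 2, 2) - h,
      #|B| = 2 * h
    & forall x : Xtype h,
        delta <= deg (L_graph (Wtype k h) H B) (inr (inl x))].

Definition L_family (n k delta : nat) (T : finType) (G : sgraph T) : Prop :=
  exists (H : sgraph (Xtype (delta - k)))
         (B : {set Xtype (delta - k) * Ytype n k (delta - k)}),
    L_data H B /\ isomorphic G (L_graph (Wtype k (delta - k)) H B).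

(* Main.v *)
Require Import Defs.
From mathcomp Require Import all_boot all_order all_algebra all_fingroup.
From mathcomp Require Import reals complex.
From mathcomp Require Import ring lra zify.

Set Implicit Arguments.
Unset Strict Implicit.
Unset Printing Implicit Defensive.

Import Order.TTheory GRing.Theory Num.Theory.

(** Why the theorem holds.

A graph of the family is a clique [W + Y] with the graph [H] on [X] attached to
it.  Write [M] for the missing-edge graph.  The degree condition says that every
[x] has at least [deg M x] neighbours in [Y]; both quantities sum to [2h] over
[X], so they agree ([L_dataP], [tight]).  Hence [x] has exactly
[d x = #|W| + deg M x] neighbours in the clique.

Eliminating the clique from the eigenvalue equation leaves a problem of size
[#|X|] that does not involve [n].  Fix a real [lam], put
[q = lam (lam + 1)] and [P = (lam + 1) A_H + N], where [N x x'] is the number of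
common neighbours of [x] and [x'] in the clique ([gram]), and let [w] solve
[q w = q d + P w].  Then [w] extends to a nonnegative vector [f] on the whole
graph with [A f = lam f + c 1_clique], where [c] depends on [H] and on the
boundary edges only through an increasing function of [d . w]
([lifted_eigen]).  Pairing [f] with a nonnegative sub-eigenvector gives [c >= 0]
when [lam] is the spectral radius of the graph, and by the Rayleigh principle
[c > 0] makes the spectral radius exceed [lam].  So of two graphs on the same
vertex set the one with the larger [d . w], taken at
[lam = rho] of the other, has the larger spectral radius ([rho_lt_of_dot]).

For large [lam] one has [w = d + O(1/lam)], and [d . w] expands as
[d . d + d A_H d / lam + (d A_H^2 d + d N d) / lam^2 + ...].  Two graphs are
therefore compared lexicographically ([data_lt], [rho_lt_of_data]):
- first by the sum of the [d x ^ 2], i.e. by the sum of the squared degrees of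
  [M], which is largest exactly when any two adjacent vertices of [M] have
  degree sum [h + 1] ([sqdeg_le], [sqdeg_max]);
- then by [d A_H d], i.e. by smallness of the sum of [d u * d v] over the edges
  of [M]; when the degree sums are [h + 1] the minimum requires every edge to
  have end degrees [1] and [h], so that [M] is a star
  ([quad_edge_min], [star_of_edge_degrees]); this is what separates the star
  from the triangle when [h = 3];
- finally, for a fixed star [M], by [d N d], which is largest exactly when all
  leaves are attached to one common neighbour of the centre
  ([data_lt_or_star_form]).
All error terms are bounded in terms of [#|X|] and [#|W|] alone, which gives a
threshold for [n] depending only on [k] and [delta].  Any two graphs of the
shape singled out by the three steps are isomorphic ([star_form_iso]).  When
[h = 0] nothing is missing from [H], there are no boundary edges, and the family
has a single class ([L_iso_h0]). *)

(** * Spectral radius of a graph *)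
Section Diagonalized.
Local Open Scope ring_scope.
Variables (F : fieldType) (n : nat) (A P : 'M[F]_n) (D : 'rV[F]_n).
Hypotheses (P_unit : P \in unitmx) (PA : P *m A = diag_mx D *m P).

Lemma eigenvalue_diag i : eigenvalue A (D 0 i).
Proof.
apply/eigenvalueP; exists (row i P).
  by rewrite -row_mul PA row_mul row_diag_mx -scalemxAl -rowE.
apply/eqP=> P0; move: P_unit; rewrite -row_free_unit.
move=> /row_freeP[Q /(congr1 (row i))/rowP/(_ i)].
by rewrite row_mul P0 mul0mx !mxE eqxx => /eqP; rewrite eq_sym oner_eq0.
Qed.

Lemma eigenvalue_diagE z : eigenvalue A z -> exists i, z = D 0 i.
Proof.
move=> /eigenvalueP[v vA v0]; pose y := v *m invmx P.
have yD : y *m diag_mx D = z *: y.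
  rewrite /y scalemxAl -vA -[v in RHS](mulmxKV P_unit) -!mulmxA.
  by rewrite (mulmxA P) PA -mulmxA mulmxV // mulmx1.
have /rV0Pn[i yi] : y != 0.
  apply: contra_neq v0 => y0.
  by rewrite -[v](mulmxKV P_unit) -/y y0 mul0mx.
exists i; apply: (mulIf yi); move/rowP/(_ i): yD.
by rewrite mul_mx_diag mxE [in RHS]mxE mulrC => ->.
Qed.

End Diagonalized.

Section Spectral.
Local Open Scope ring_scope.
Variables (R : realType) (T : finType) (G : sgraph T).
Local Notation A := (adjmx R G).
Local Notation toC x := (real_complex R x).

Lemma adjmx_diagonalizable : exists (P : 'M[R[i]]_#|T|) (D : 'rV_#|T|),
  P \is unitarymx /\ P *m A = diag_mx D *m P.
Proof.
have /orthomx_spectralP E : A \is normalmx.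
  apply: symmetric_normalmx.
    apply/is_hermitianmxP; rewrite expr0 scale1r map_mx_id //.
    by apply/matrixP=> i j; rewrite !mxE adj_sym.
  by apply/mxOverP=> i j; rewrite mxE realn.
exists (spectralmx A), (spectral_diag A).
split; first exact: spectral_unitarymx.
by rewrite {2}E -!mulmxA mulKVmx // spectral_unit.
Qed.

Lemma Re_norm (z : R[i]) : toC (complex.Re `|z|) = `|z|.
Proof. by rewrite normc_def. Qed.

Hypothesis T_gt0 : (0 < #|T|)%N.

Lemma max_eigenvalue : exists2 z, eigenvalue A z &
  forall t, eigenvalue A t -> complex.Re `|t| <= complex.Re `|z|.
Proof.
have [P [D [/unitarymx_unit Pu PA]]] := adjmx_diagonalizable.
pose i0 := [arg max_(i > Ordinal T_gt0) complex.Re `|D 0 i|]%O.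
exists (D 0 i0) => [|t /(eigenvalue_diagE Pu PA)[i ->]].
  exact: (eigenvalue_diag Pu PA).
by rewrite /i0; case: Order.TotalTheory.arg_maxP => // j _; apply.
Qed.

Lemma norm_eigenvalue_le z : eigenvalue A z -> `|z| <= toC (rho R G).
Proof.
move=> Az; rewrite -Re_norm lecR; apply: ub_le_sup; last by exists z.
have [t _ t_max] := max_eigenvalue.
by exists (complex.Re `|t|); move=> _ [z' Az' <-]; exact: t_max.
Qed.

Lemma rho_attained : exists2 z, eigenvalue A z & `|z| = toC (rho R G).
Proof.
have [t At t_max] := max_eigenvalue; exists t => //.
apply/eqP; rewrite eq_le norm_eigenvalue_le //= -Re_norm lecR.
apply: ge_sup; first by exists (complex.Re `|t|), t.
by move=> _ [z Az <-]; exact: t_max.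
Qed.

Lemma sum_enum_val (V : nmodType) (F : T -> V) :
  \sum_(i < #|T|) F (enum_val i) = \sum_x F x.
Proof. by rewrite -(big_enum_val (A := T)). Qed.

(** The moduli of an eigenvector for an eigenvalue of modulus [rho], by the
    triangle inequality. It plays the part of a Perron eigenvector. *)
Lemma rho_subeigen : exists u : T -> R,
  [/\ forall x, 0 <= u x, exists x, u x != 0
    & forall x, rho R G * u x <= \sum_y (G x y)%:R * u y].
Proof.
have [z /eigenvalueP[v vA /rV0Pn[i vi]] Ez] := rho_attained.
exists (fun x => complex.Re `|v 0 (enum_rank x)|); split.
- by move=> x; rewrite -lecR Re_norm normr_ge0.
- exists (enum_val i).
  by rewrite enum_valK -(inj_eq (@complexI R)) Re_norm normr_eq0.
move=> x; rewrite -lecR rmorphM /= Re_norm -Ez -normrM.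
have -> : z * v 0 (enum_rank x) = \sum_i v 0 i * A i (enum_rank x).
  by move/rowP/(_ (enum_rank x)): vA; rewrite !mxE.
apply: (le_trans (ler_norm_sum _ _ _)).
rewrite rmorph_sum /= -sum_enum_val; apply: ler_sum => j _.
rewrite rmorphM /= Re_norm enum_valK mxE enum_rankK adj_sym normrM mulrC.
by case: (G x _) => /=; rewrite ?normr1 ?normr0 ?rmorph1 ?rmorph0.
Qed.

Local Open Scope sesquilinear_scope.

(** In a unitary eigenbasis the quadratic form is a combination of squared
    moduli with coefficients the eigenvalues, all of modulus at most [rho]. *)
Lemma rho_rayleigh (v : T -> R) :
  \sum_x v x * (\sum_y (G x y)%:R * v y) <= rho R G * \sum_x v x ^+ 2.
Proof.
have [P [D [Pu PA]]] := adjmx_diagonalizable.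
have Ainv : A = invmx P *m diag_mx D *m P.
  by rewrite -mulmxA -PA mulKmx // unitarymx_unit.
pose V : 'rV[R[i]]_#|T| := \row_i toC (v (enum_val i)).
have Vconj : map_mx Num.conj V = V.
  by apply/rowP=> i; rewrite !mxE; apply/CrealP/complex_realP; eexists.
pose y := V *m P^t*.
have PPt : P^t* *m P = 1%:M.
  by rewrite -invmx_unitary // mulVmx ?unitarymx_unit.
have yt : y ^t* = P *m V^T.
  by rewrite /y trmx_mul map_mxM trmxCK -map_trmx Vconj.
have norm2 : \sum_i `|y 0 i| ^+ 2 = toC (\sum_x v x ^+ 2).
  transitivity ((y *m y^t*) 0 0).
    by rewrite mxE; apply: eq_bigr => i _; rewrite !mxE -normCK.
  rewrite yt /y -mulmxA (mulmxA _ P) PPt mul1mx mxE rmorph_sum /= -sum_enum_val.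
  by apply: eq_bigr => i _; rewrite !mxE -rmorphM.
have quad : \sum_i D 0 i * `|y 0 i| ^+ 2
    = toC (\sum_x v x * (\sum_y (G x y)%:R * v y)).
  transitivity ((y *m diag_mx D *m y^t*) 0 0).
    rewrite mxE; apply: eq_bigr => i _.
    by rewrite mul_mx_diag !mxE mulrAC mulrC normCK.
  have -> : y *m diag_mx D *m y^t* = V *m A *m V^T.
    by rewrite yt Ainv invmx_unitary // /y !mulmxA.
  rewrite mxE rmorph_sum /= -sum_enum_val.
  under [LHS]eq_bigr do rewrite mxE mulr_suml.
  rewrite exchange_big /=; apply: eq_bigr => i _.
  rewrite rmorphM rmorph_sum /= mulr_sumr -sum_enum_val.
  apply: eq_bigr => j _.
  by rewrite !mxE rmorphM /= rmorph_nat -mulrA; congr (_ * _); rewrite mulrC.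
rewrite -lecR -quad rmorphM /= -norm2 mulr_sumr.
apply: (le_trans (real_ler_norm _)).
  by rewrite quad; apply/complex_realP; eexists.
apply: (le_trans (ler_norm_sum _ _ _)); apply: ler_sum => i _.
rewrite normrM [`|_ ^+ 2|]ger0_norm ?exprn_ge0 //.
by rewrite ler_wpM2r ?exprn_ge0 // norm_eigenvalue_le //;
   exact: (eigenvalue_diag (unitarymx_unit Pu) PA).
Qed.

End Spectral.

(** * Isomorphism invariance and a nonnegative resolvent *)
Section Isomorphism.
Local Open Scope ring_scope.

Lemma isomorphic_sym (T1 T2 : finType) (G1 : sgraph T1) (G2 : sgraph T2) :
  isomorphic G1 G2 -> isomorphic G2 G1.
Proof.
case=> f [[g fK gK] fG]; exists g; split; first by exists f.
by move=> x y; rewrite -fG !gK.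
Qed.

Lemma isomorphic_trans (T1 T2 T3 : finType) (G1 : sgraph T1) (G2 : sgraph T2)
    (G3 : sgraph T3) :
  isomorphic G1 G2 -> isomorphic G2 G3 -> isomorphic G1 G3.
Proof.
case=> f [fbij fG] [g [gbij gG]]; exists (g \o f); split; first exact: bij_comp.
by move=> x y /=; rewrite gG fG.
Qed.

(** A sub-eigenvector of [G1], transported to [G2], is a test vector whose
    Rayleigh quotient is at least [rho R G1]. *)
Lemma rho_iso_le (R : realType) (T1 T2 : finType)
    (G1 : sgraph T1) (G2 : sgraph T2) :
  (0 < #|T1|)%N -> isomorphic G1 G2 -> rho R G1 <= rho R G2.
Proof.
move=> T_gt0 [f [fbij fG]]; have [g fK gK] := fbij.
have [u [u_ge0 [x0 ux0] uG]] := rho_subeigen R G1 T_gt0.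
have T2_gt0 : (0 < #|T2|)%N by apply/card_gt0P; exists (f x0).
have norm_gt0 : 0 < \sum_x u x ^+ 2.
  rewrite (bigD1 x0) //= ltr_pwDl ?exprn_even_gt0 ?sumr_ge0 // => x _.
  exact: sqr_ge0.
rewrite -(ler_pM2r norm_gt0).
have := rho_rayleigh (R := R) G2 T2_gt0 (u \o g).
rewrite (reindex f) /=; last exact: onW_bij.
rewrite [X in _ <= _ * X](reindex f) /=; last exact: onW_bij.
under [X in _ <= _ * X]eq_bigr do rewrite fK.
apply: le_trans; rewrite mulr_sumr; apply: ler_sum => x _.
rewrite fK expr2 mulrCA; apply: ler_wpM2l => //.
apply: (le_trans (uG x)); rewrite [leRHS](reindex f) /=; last exact: onW_bij.
by apply: ler_sum => y _; rewrite fG fK.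
Qed.

Lemma rho_iso (R : realType) (T1 T2 : finType)
    (G1 : sgraph T1) (G2 : sgraph T2) :
  (0 < #|T1|)%N -> isomorphic G1 G2 -> rho R G1 = rho R G2.
Proof.
move=> T_gt0 iso12; apply/eqP; rewrite eq_le rho_iso_le //=.
apply: rho_iso_le; last exact: isomorphic_sym.
by case: iso12 => f [/bij_eq_card <-].
Qed.

End Isomorphism.

Section Resolvent.
Local Open Scope ring_scope.
Variables (R : realFieldType) (X : finType) (P : X -> X -> R) (q r : R).
Hypotheses (P_ge0 : forall i j, 0 <= P i j)
  (P_sum : forall i, \sum_j P i j <= r) (r_le : 2 * r <= q) (q_gt0 : 0 < q).

(** At an index where [`|v|] is largest the equation gives
    [q `|v i| <= r `|v i|], whereas [r <= q / 2]. *)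
Lemma resolvent_kernel (v : X -> R) :
  (forall i, q * v i = \sum_j P i j * v j) -> forall i, v i = 0.
Proof.
move=> qv i; pose i0 := [arg max_(j > i) `|v j|]%O.
have vmax j : `|v j| <= `|v i0|.
  by rewrite /i0; case: Order.TotalTheory.arg_maxP => // k _; apply.
have : q * `|v i0| <= r * `|v i0|.
  rewrite -[q in q * _]gtr0_norm // -normrM qv.
  apply: (le_trans (ler_norm_sum _ _ _)).
  apply: le_trans (ler_wpM2r (normr_ge0 _) (P_sum i0)); rewrite mulr_suml.
  apply: ler_sum => j _; rewrite normrM (ger0_norm (P_ge0 _ _)).
  exact: ler_wpM2l.
have := vmax i; have := normr_ge0 (v i) => ? ? ?.
apply/eqP; rewrite -normr_le0 leNgt; apply/negP => vi_gt0.
have : 0 < `|v i0| * (q - r).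
  apply: mulr_gt0; first exact: lt_le_trans vi_gt0 (vmax i).
  by have := r_le; have := q_gt0; lra.
by lra.
Qed.

Lemma resolvent_exists (b : X -> R) :
  exists w : X -> R, forall i, q * w i = b i + \sum_j P i j * w j.
Proof.
pose Q : 'M[R]_#|X| :=
  \matrix_(i, j) (q *+ (i == j) - P (enum_val j) (enum_val i)).
have QE (v : 'rV_#|X|) j :
    (v *m Q) 0 j = q * v 0 j
      - \sum_x P (enum_val j) x * v 0 (enum_rank x).
  rewrite mxE; under eq_bigr do rewrite mxE mulrBr.
  rewrite sumrB; congr (_ - _).
    rewrite (bigD1 j) //= eqxx big1 ?addr0 1?mulrC // => i /negPf ->.
    by rewrite mulr0.
  rewrite -[RHS]sum_enum_val; apply: eq_bigr => i _.
  by rewrite enum_valK mulrC.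
have Q_unit : Q \in unitmx.
  rewrite -row_free_unit -kermx_eq0; apply/rowV0P => v /sub_kermxP vQ0.
  have v0 : forall x, v 0 (enum_rank x) = 0.
    apply: (@resolvent_kernel (fun x => v 0 (enum_rank x))) => x.
    move/rowP/(_ (enum_rank x))/eqP: vQ0.
    by rewrite QE mxE enum_rankK subr_eq0 => /eqP.
  by apply/rowP=> i; rewrite mxE -(v0 (enum_val i)) enum_valK.
pose c : 'rV[R]_#|X| := \row_i b (enum_val i).
exists (fun x => (c *m invmx Q) 0 (enum_rank x)) => x.
have /rowP/(_ (enum_rank x)) := mulmxKV Q_unit c.
by rewrite QE [RHS]mxE enum_rankK => <-; rewrite subrK.
Qed.

(** The three bounds come from evaluating the equation at an index where [w] is
    smallest, which gives [w >= 0] and then [d <= w], and at an index where it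
    is largest, which gives [w <= 2 D] and then the bound on [w - d]. *)
Lemma resolvent_bounds (d : X -> R) (D : R) :
  (forall i, 0 <= d i <= D) ->
  exists w : X -> R, forall i,
    [/\ q * w i = q * d i + \sum_j P i j * w j,
        d i <= w i & q * (w i - d i) <= 2 * D * r].
Proof.
move=> dD; have [w wP] := resolvent_exists (fun i => q * d i).
have Pw i c : (forall j, c <= w j) -> c <= 0 -> r * c <= \sum_j P i j * w j.
  move=> cw c0; apply: (@le_trans _ _ (\sum_j P i j * c)).
    rewrite -mulr_suml; exact: ler_wnM2r.
  by apply: ler_sum => j _; apply: ler_wpM2l.
have w_ge0 i : 0 <= w i.
  pose i0 := [arg min_(j < i) w j]%O.
  have wmin j : w i0 <= w j.
    by rewrite /i0; case: Order.TotalTheory.arg_minP => // k _; apply.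
  apply: le_trans (wmin i); rewrite leNgt; apply/negP => wi0.
  have := Pw i0 (w i0) wmin (ltW wi0); have /andP[d0 _] := dD i0.
  have : w i0 * (q - r) < 0.
    by rewrite nmulr_rlt0 //; have := r_le; have := q_gt0; lra.
  by have := wP i0; have := mulr_ge0 (ltW q_gt0) d0; lra.
have Pw_le i c : (forall j, w j <= c) -> \sum_j P i j * w j <= r * c.
  move=> cw; have c0 : 0 <= c by apply: le_trans (cw i).
  apply: (@le_trans _ _ (\sum_j P i j * c)).
    by apply: ler_sum => j _; apply: ler_wpM2l.
  rewrite -mulr_suml; exact: ler_wpM2r.
have w_le i : w i <= 2 * D.
  pose i0 := [arg max_(j > i) w j]%O.
  have wmax j : w j <= w i0.
    by rewrite /i0; case: Order.TotalTheory.arg_maxP => // k _; apply.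
  apply: (le_trans (wmax i)).
  have := Pw_le i0 _ wmax; have /andP[_ dD0] := dD i0; have := wP i0.
  have := w_ge0 i0 => w0 E1 E2.
  have : q * w i0 <= q * D + r * w i0 by rewrite E1 lerD // ler_pM2l.
  have : 2 * r * w i0 <= q * w i0 by apply: ler_wpM2r.
  by rewrite -[w i0 <= _](ler_pM2l q_gt0); lra.
exists w => i; split; first exact: wP.
  rewrite -(ler_pM2l q_gt0) wP lerDl; apply: sumr_ge0 => j _.
  exact: mulr_ge0.
rewrite mulrBr wP addrC addKr (le_trans (Pw_le i _ w_le)) //.
by rewrite mulrC.
Qed.

End Resolvent.

(** * Comparison of resolvents for large parameters *)
Definition quad (X : finType) (Q : X -> X -> nat) (d : X -> nat) : nat :=
  (\sum_x d x * \sum_y Q x y * d y)%N.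

(** [A] stands for adjacency in [X], [N] for numbers of common neighbours in
    the clique and [d] for numbers of neighbours in the clique. *)
Definition bounded_data (X : finType) (D : nat) (A N : X -> X -> nat)
    (d : X -> nat) : Prop :=
  (forall x y, A x y <= 1 /\ N x y <= D)%N /\ forall x, (d x <= D)%N.

(** [row_bound p D * lam] bounds the row sums of [schur_kernel] when
    [lam >= 1], as [lam + 1 <= 2 lam]. *)
Definition row_bound (p D : nat) : nat := (p * (2 + D))%N.

(** Each summand serves one requirement: [2 K] the hypothesis on row sums in
    [resolvent_bounds]; the next three the error terms when the squared norms,
    respectively the quadratic forms of [A], are compared; the last but one the
    error term when the forms of [N] are compared. *)
Definition threshold (p D : nat) : nat :=
  let K := row_bound p D in
  (2 * K + 2 * p * D ^ 2 * K + 2 * p * D ^ 2 * K ^ 2 + p ^ 2 * D ^ 3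
   + 6 * p ^ 2 * D ^ 3 * K + 1)%N.

Section Comparison.
Local Open Scope ring_scope.
Variables (R : realFieldType) (X : finType) (D : nat) (lam : R).
Local Notation p := #|X|.
Local Notation K := (row_bound p D).
Hypothesis lam_ge : (threshold p D)%:R <= lam.
Local Notation q := (lam * (lam + 1)).
Local Notation e := (2 * D%:R * K%:R / (lam + 1)).

(** Prescribing the clique sum [s] of an eigenvector with value [w] on [X]
    gives [(lam + 1) f = s + C w] on the clique, with [C] the adjacency between
    the clique and [X]. Substituting this into the equations on [X] and
    multiplying by [lam + 1] gives [lam (lam + 1) w = s d + P w], where [P] is
    this kernel. *)
Definition schur_kernel (A N : X -> X -> nat) (x y : X) : R :=
  (lam + 1) * (A x y)%:R + (N x y)%:R.

Definition schur_solution (A N : X -> X -> nat) (d : X -> nat) (w : X -> R) :=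
  forall x, q * w x = q * (d x)%:R + \sum_y schur_kernel A N x y * w y.

Definition near_data (d : X -> nat) (w : X -> R) :=
  forall x, (d x)%:R <= w x <= (d x)%:R + e.

Lemma threshold_split :
  [/\ 1 <= lam, 2 * K%:R <= lam, 2 * p%:R * D%:R ^+ 2 * K%:R < lam,
      2 * p%:R * D%:R ^+ 2 * K%:R ^+ 2 + p%:R ^+ 2 * D%:R ^+ 3 < lam
    & 6 * p%:R ^+ 2 * D%:R ^+ 3 * K%:R < lam].
Proof.
have := lam_ge; rewrite /threshold.
move: (row_bound #|X| D) => k; move: #|X| => p.
have := (ler0n R (2 * k), ler0n R (2 * p * D ^ 2 * k),
  ler0n R (2 * p * D ^ 2 * k ^ 2), ler0n R (p ^ 2 * D ^ 3),
  ler0n R (6 * p ^ 2 * D ^ 3 * k)).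
by rewrite !natrD !natrM => -[[[[? ?] ?] ?] ?] ?; split; lra.
Qed.

Lemma sum_le_card (F : X -> R) c :
  (forall x, F x <= c) -> \sum_x F x <= p%:R * c.
Proof.
move=> Fc; apply: (le_trans (ler_sum _ (fun x _ => Fc x))).
by rewrite sumr_const mulr_natl.
Qed.

Lemma schur_kernel_ge0 A N x y : 0 <= schur_kernel A N x y.
Proof.
by have [? _ _ _ _] := threshold_split; rewrite addr_ge0 ?mulr_ge0 //; lra.
Qed.

Lemma schur_kernel_sum A N d x :
  bounded_data D A N d -> \sum_y schur_kernel A N x y <= K%:R * lam.
Proof.
have [lam1 _ _ _ _] := threshold_split => -[AN _].
apply: le_trans (_ : p%:R * ((2 + D%:R) * lam) <= _); last first.
  by rewrite /row_bound natrM natrD mulrA.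
apply: sum_le_card => y; rewrite /schur_kernel.
have [Axy Nxy] := AN x y.
have : (A x y)%:R <= 1 :> R by rewrite -[1]/(1%:R) ler_nat.
have : (N x y)%:R <= D%:R :> R by rewrite ler_nat.
have : 0 <= D%:R :> R by [].
have : 0 <= (A x y)%:R :> R by [].
by nra.
Qed.

Lemma schur_solution_exists A N d : bounded_data D A N d ->
  exists w, schur_solution A N d w /\ near_data d w.
Proof.
move=> bd; have [lam1 lamK _ _ _] := threshold_split.
have lam1_gt0 : 0 < lam + 1 by lra.
have q_gt0 : 0 < q by apply: mulr_gt0; lra.
have Kq : 2 * (K%:R * lam) <= q by nra.
have dD x : (0 <= (d x)%:R :> R) && ((d x)%:R <= D%:R :> R).
  by rewrite ler0n ler_nat; case: bd => _ ->.
have [w wP] := resolvent_bounds (schur_kernel_ge0 A N)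
  (fun x => schur_kernel_sum x bd) Kq q_gt0 dD.
exists w; split=> x; have [E dw we] := wP x => //; rewrite dw /= -lerBlDl.
rewrite ler_pdivlMr // -(ler_pM2r (_ : 0 < lam)); last lra.
by move: we; lra.
Qed.

Lemma error_bounds : [/\ 0 <= e, e <= D%:R, p%:R * (D%:R * e) < 1 &
  p%:R * (p%:R * (D%:R * (3 * D%:R * e))) < 1].
Proof.
have [lam1 lam2 lam3 _ lam5] := threshold_split.
have lam1_gt0 : 0 < lam + 1 by lra.
have D0 : 0 <= D%:R :> R by [].
split.
- by rewrite divr_ge0 ?mulr_ge0 //; lra.
- by rewrite ler_pdivrMr //; nra.
- by rewrite !mulrA ltr_pdivrMr //; lra.
- by rewrite !mulrA ltr_pdivrMr //; lra.
Qed.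

Section Pair.
Variables (A N A' N' : X -> X -> nat) (d d' : X -> nat) (w w' : X -> R).
Hypotheses (bd : bounded_data D A N d) (bd' : bounded_data D A' N' d')
  (sol : schur_solution A N d w) (sol' : schur_solution A' N' d' w')
  (near : near_data d w) (near' : near_data d' w').

Lemma data_le x : (0 <= (d x)%:R :> R) && ((d x)%:R <= D%:R :> R).
Proof. by rewrite ler0n ler_nat; case: bd => _ ->. Qed.

(** [w] agrees with [d] up to an error smaller than [1] in the scalar product
    with [d], while the integer squared norms differ by at least [1]. *)
Lemma dot_lt_of_sqnorm :
  (\sum_x d x ^ 2 < \sum_x d' x ^ 2)%N ->
  \sum_x (d x)%:R * w x < \sum_x (d' x)%:R * w' x.
Proof.
move=> dd'; have [e0 _ e1 _] := error_bounds.
apply: (@lt_le_trans _ _ (\sum_x (d' x)%:R ^+ 2)); last first.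
  apply: ler_sum => x _; rewrite expr2 ler_wpM2l //.
  by have /andP[] := near' x.
apply: (@lt_le_trans _ _ ((\sum_x d x ^ 2)%N%:R + 1)); last first.
  rewrite natr1; under [leRHS]eq_bigr do rewrite -natrX.
  by rewrite -natr_sum ler_nat.
apply: (@le_lt_trans _ _ ((\sum_x d x ^ 2)%N%:R + p%:R * (D%:R * e)));
  last by rewrite ltrD2l.
rewrite -lerBlDl natr_sum -sumrB; apply: sum_le_card => x.
have /andP[d0 dD] := data_le x; have /andP[_ we] := near x.
by rewrite natrX; nra.
Qed.

Lemma dot_schur_solution : q * \sum_x (d x)%:R * w x
  = q * \sum_x (d x)%:R ^+ 2
    + \sum_x (d x)%:R * \sum_y schur_kernel A N x y * w y.
Proof.
rewrite !mulr_sumr -big_split /=; apply: eq_bigr => x _.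
by rewrite mulrCA sol; ring.
Qed.

Lemma quadR (Q : X -> X -> nat) (f : X -> nat) :
  (quad Q f)%:R = \sum_x (f x)%:R * \sum_y (Q x y)%:R * (f y)%:R :> R.
Proof.
rewrite natr_sum; apply: eq_bigr => x _; rewrite natrM natr_sum.
by congr (_ * _); apply: eq_bigr => y _; rewrite natrM.
Qed.

End Pair.

Lemma schur_quad A N d :
  \sum_x (d x)%:R * \sum_y schur_kernel A N x y * (d y)%:R
  = (lam + 1) * (quad A d)%:R + (quad N d)%:R.
Proof.
rewrite !quadR mulr_sumr -big_split /=; apply: eq_bigr => x _.
rewrite mulrCA -mulrDr; congr (_ * _); rewrite mulr_sumr -big_split /=.
by apply: eq_bigr => y _; rewrite mulrDl mulrA.
Qed.

(** After one substitution of the equation into itself the first-order term is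
    [(lam + 1) (quad A d)], and its integer gap beats the remaining terms,
    which stay bounded. *)
Lemma dot_lt_of_quad A N A' N' d d' w w' :
  bounded_data D A N d ->
  schur_solution A N d w -> schur_solution A' N' d' w' ->
  near_data d w -> near_data d' w' ->
  (\sum_x d x ^ 2 = \sum_x d' x ^ 2)%N -> (quad A d < quad A' d')%N ->
  \sum_x (d x)%:R * w x < \sum_x (d' x)%:R * w' x.
Proof.
move=> bd sol sol' near near' sq_eq quad_lt.
have [lam1 lam2 lam3 lam4 lam5] := threshold_split.
have [e0 _ _ _] := error_bounds.
have q_gt0 : 0 < q by apply: mulr_gt0; lra.
rewrite -(ltr_pM2l q_gt0) (dot_schur_solution sol) (dot_schur_solution sol').
have -> : \sum_x (d x)%:R ^+ 2 = \sum_x (d' x)%:R ^+ 2 :> R.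
  under eq_bigr do rewrite -natrX; under [RHS]eq_bigr do rewrite -natrX.
  by rewrite -!natr_sum sq_eq.
rewrite ltrD2l.
have low : \sum_x (d' x)%:R * \sum_y schur_kernel A' N' x y * (d' y)%:R
    <= \sum_x (d' x)%:R * \sum_y schur_kernel A' N' x y * w' y.
  apply: ler_sum => x _; rewrite ler_wpM2l //; apply: ler_sum => y _.
  rewrite ler_wpM2l ?schur_kernel_ge0 //; by have /andP[] := near' y.
apply: lt_le_trans low.
have up : \sum_x (d x)%:R * \sum_y schur_kernel A N x y * w y
    <= \sum_x (d x)%:R * \sum_y schur_kernel A N x y * (d y)%:R
       + p%:R * (D%:R * (K%:R * lam * e)).
  rewrite -lerBlDl -sumrB; apply: sum_le_card => x; rewrite -mulrBr -sumrB.
  have /andP[d0 dD] := data_le bd x.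
  apply: ler_pM => //.
    apply: sumr_ge0 => y _; rewrite -mulrBr mulr_ge0 ?schur_kernel_ge0 //.
    by rewrite subr_ge0; have /andP[] := near y.
  apply: (@le_trans _ _ (\sum_y schur_kernel A N x y * e)).
    apply: ler_sum => y _; rewrite -mulrBr ler_wpM2l ?schur_kernel_ge0 //.
    by rewrite lerBlDl; have /andP[] := near y.
  by rewrite -mulr_suml ler_wpM2r // (schur_kernel_sum _ bd).
apply: (le_lt_trans up); rewrite !schur_quad.
have Nd : (quad N d)%:R <= p%:R ^+ 2 * D%:R ^+ 3 :> R.
  rewrite quadR -!mulrA; apply: sum_le_card => x.
  have /andP[d0 dD] := data_le bd x.
  have -> : p%:R * D%:R ^+ 3 = D%:R * (p%:R * (D%:R * D%:R)) :> R by ring.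
  apply: ler_pM => //; first by apply: sumr_ge0 => y _; apply: mulr_ge0.
  apply: sum_le_card => y; apply: ler_pM => //; rewrite ler_nat.
    by case: bd => /(_ x y)[].
  by case: bd => _ ->.
have : (quad A d)%:R + 1 <= (quad A' d')%:R :> R by rewrite natr1 ler_nat.
have : 0 <= (quad N' d')%:R :> R by [].
have : p%:R * (D%:R * (K%:R * lam * e)) <= 2 * p%:R * D%:R ^+ 2 * K%:R ^+ 2.
  have -> : p%:R * (D%:R * (K%:R * lam * e))
      = (2 * p%:R * D%:R ^+ 2 * K%:R ^+ 2) * (lam / (lam + 1)).
    by field; rewrite gt_eqF //; lra.
  rewrite ler_piMr ?mulr_ge0 ?exprn_ge0 // ler_pdivrMr; lra.
by nra.
Qed.

(** By symmetry of the kernels, [q (d . w' - d . w) = w (N' - N) w'], the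
    resolvent identity; to leading order this is [d (N' - N) d], an integer. *)
Lemma dot_lt_of_gram A N N' d w w' :
  bounded_data D A N d ->
  (forall x y, A x y = A y x) -> (forall x y, N x y = N y x) ->
  schur_solution A N d w -> schur_solution A N' d w' ->
  near_data d w -> near_data d w' ->
  (quad N d < quad N' d)%N ->
  \sum_x (d x)%:R * w x < \sum_x (d x)%:R * w' x.
Proof.
move=> bd symA symN sol sol' near near' quad_lt.
have [lam1 lam2 lam3 lam4 lam5] := threshold_split.
have [e0 eD _ e3] := error_bounds.
have q_gt0 : 0 < q by apply: mulr_gt0; lra.
have diff : q * \sum_x (d x)%:R * w' x - q * \sum_x (d x)%:R * w x
    = \sum_x \sum_y w x * (N' x y)%:R * w' y
      - \sum_x \sum_y w x * (N x y)%:R * w' y.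
  (* Testing the equation of each solution against the other one. *)
  have test M u v : schur_solution A M d u -> q * \sum_x (d x)%:R * v x
      = q * \sum_x u x * v x - \sum_x \sum_y schur_kernel A M x y * u y * v x.
    move=> uP; rewrite !mulr_sumr -sumrB; apply: eq_bigr => x _.
    by rewrite mulrA -mulr_suml -(addrK (\sum_y schur_kernel A M x y * u y)
      (q * _)) -uP mulrBl mulrA.
  rewrite (test N w w') // (test N' w' w) // [X in _ - X - _]exchange_big /=.
  have -> : \sum_x w' x * w x = \sum_x w x * w' x.
    by apply: eq_bigr => x _; rewrite mulrC.
  rewrite opprB addrC addrA subrK -!sumrB; apply: eq_bigr => x _.
  rewrite -!sumrB; apply: eq_bigr => y _.
  by rewrite /schur_kernel (symA y x) (symN y x); ring.
rewrite -subr_gt0 -(pmulr_rgt0 _ q_gt0) mulrBr diff subr_gt0.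
have bound x y : w x * (N x y)%:R * w' y - (d x)%:R * ((N x y)%:R * (d y)%:R)
    <= D%:R * (3 * D%:R * e).
  have /andP[dx0 dxD] := data_le bd x; have /andP[dy0 dyD] := data_le bd y.
  have /andP[wx1 wx2] := near x; have /andP[wy1 wy2] := near' y.
  have -> : w x * (N x y)%:R * w' y - (d x)%:R * ((N x y)%:R * (d y)%:R)
     = (N x y)%:R * (w x * w' y - (d x)%:R * (d y)%:R) by ring.
  have N0 : (0 <= (N x y)%:R :> R) && ((N x y)%:R <= D%:R :> R).
    by rewrite ler0n ler_nat; case: bd => /(_ x y)[].
  have : 0 <= w x * w' y - (d x)%:R * (d y)%:R <= 3 * D%:R * e by nra.
  by case/andP: N0 => ? ? /andP[? ?]; apply: ler_pM.
have up : \sum_x \sum_y w x * (N x y)%:R * w' y < (quad N d)%:R + 1.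
  apply: (@le_lt_trans _ _
    ((quad N d)%:R + p%:R * (p%:R * (D%:R * (3 * D%:R * e)))));
    last by rewrite ltrD2l.
  rewrite -lerBlDl quadR -sumrB; apply: sum_le_card => x.
  by rewrite mulr_sumr -sumrB; apply: sum_le_card.
apply: (lt_le_trans up); rewrite natr1.
apply: (@le_trans _ _ (quad N' d)%:R); first by rewrite ler_nat.
rewrite quadR; apply: ler_sum => x _; rewrite mulr_sumr; apply: ler_sum => y _.
have /andP[wx1 wx2] := near x; have /andP[wy1 wy2] := near' y.
by rewrite mulrA; apply: ler_pM; rewrite ?mulr_ge0 // ler_pM.
Qed.

End Comparison.

(** * Elimination of the clique *)
Section Reduction.
Local Open Scope ring_scope.
Variables (W X Y : finType).

Definition nbhd (B : {set X * Y}) (x : X) : {set Y} := [set y | (x, y) \in B].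

Definition outdeg (B : {set X * Y}) (x : X) : nat := (#|W| + #|nbhd B x|)%N.

Definition gram (B : {set X * Y}) (x x' : X) : nat :=
  (#|W| + #|nbhd B x :&: nbhd B x'|)%N.

Definition hadj (H : sgraph X) (x x' : X) : nat := H x x'.

Variables (R : realType) (H : sgraph X) (B : {set X * Y}).
Local Notation G := (L_graph W H B).

(** The extension of [w] to all vertices: on the clique, the solution of
    [(lam + 1) f = lam (lam + 1) + C w], with [C] the adjacency between the
    clique and [X]. *)
Definition lifted (lam : R) (w : X -> R) (u : W + (X + Y)) : R :=
  match u with
  | inl _ => lam + (\sum_x w x) / (lam + 1)
  | inr (inl x) => w x
  | inr (inr y) => lam + (\sum_x ((x, y) \in B)%:R * w x) / (lam + 1)
  end.

Definition in_clique (u : W + (X + Y)) : bool :=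
  if u is inr (inl _) then false else true.

(** The amount by which [lifted] fails the eigenvalue equation at each clique
    vertex. *)
Definition defect (lam : R) (w : X -> R) : R :=
  (#|W| + #|Y|)%N%:R * lam + (\sum_x (outdeg B x)%:R * w x) / (lam + 1)
  - lam * (lam + 1).

Lemma natr_card_nbhd x : (#|nbhd B x|)%:R = \sum_y ((x, y) \in B)%:R :> R.
Proof.
rewrite -sum1_card natr_sum big_mkcond; apply: eq_bigr => y _.
by rewrite inE; case: ifP.
Qed.

Lemma natr_card_nbhdI x x' : (#|nbhd B x :&: nbhd B x'|)%:R
  = \sum_y ((x, y) \in B)%:R * ((x', y) \in B)%:R :> R.
Proof.
rewrite -sum1_card natr_sum big_mkcond; apply: eq_bigr => y _.
by rewrite !inE; do 2!case: (_ \in B); rewrite ?mulr0 ?mulr1 ?mul0r.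
Qed.

Lemma sum_neq (V : zmodType) (T : finType) (F : T -> V) t :
  \sum_(s | t != s) F s = \sum_s F s - F t.
Proof.
rewrite [in RHS](bigD1 t) //= addrAC subrr add0r.
by apply: eq_bigl => s; rewrite eq_sym.
Qed.

Lemma sum_natr_neq (T : finType) (F : T -> R) t :
  \sum_s (t != s)%:R * F s = \sum_s F s - F t.
Proof.
rewrite -sum_neq [RHS]big_mkcond; apply: eq_bigr => s _.
by case: (t != s); rewrite ?mul1r ?mul0r.
Qed.

Lemma sum_const_natr (T : finType) (c : R) : \sum_(t : T) c = #|T|%:R * c.
Proof. by rewrite sumr_const mulr_natl. Qed.

Lemma lifted_sum_clique (lam : R) (w : X -> R) :
  \sum_(u : W) lifted lam w (inl u) + \sum_y lifted lam w (inr (inr y)) =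
  (#|W| + #|Y|)%N%:R * lam + (\sum_x (outdeg B x)%:R * w x) / (lam + 1).
Proof.
rewrite /= sum_const_natr big_split /= sum_const_natr -mulr_suml.
rewrite exchange_big /=.
under [X in _ + (_ + X / _)]eq_bigr do rewrite -mulr_suml -natr_card_nbhd.
under [X in _ = _ + X / _]eq_bigr do rewrite natrD mulrDl.
by rewrite big_split /= -mulr_sumr natrD; ring.
Qed.

(** At a clique vertex the equation holds up to the difference between the
    clique sum of [f] and [lam (lam + 1)], by the choice of [f] there; at a
    vertex of [X] it is the equation defining [w], divided by [lam + 1]. *)
Lemma lifted_eigen (lam : R) (w : X -> R) : 0 < lam + 1 ->
  schur_solution lam (hadj H) (gram B) (outdeg B) w ->
  forall u, \sum_v (G u v)%:R * lifted lam w v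
     = lam * lifted lam w u + (in_clique u)%:R * defect lam w.
Proof.
move=> lam1 sol u; have lam_neq0 : lam + 1 != 0 by rewrite gt_eqF.
rewrite big_sumType big_sumType /=.
have cl := lifted_sum_clique lam w.
case: u => [u|[x|y]].
- rewrite /L_adj /=.
  under eq_bigr do rewrite orbF. rewrite (sum_natr_neq (fun=> _)).
  under [X in _ + (X + _)]eq_bigr do rewrite mul1r.
  under [X in _ + (_ + X)]eq_bigr do rewrite mul1r.
  rewrite mul1r /defect -cl /=; set a := \sum_x _; set b := \sum_y _.
  by set c := \sum_x _; field.
- rewrite /L_adj /= mul0r addr0.
  under eq_bigr do rewrite mul1r.
  under [X in _ + (X + _)]eq_bigr do rewrite orbF.
  rewrite sum_const_natr.
  have -> : \sum_y ((x, y) \in B)%:R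
        * (lam + (\sum_x' ((x', y) \in B)%:R * w x') / (lam + 1))
      = (#|nbhd B x|)%:R * lam
        + (\sum_x' (#|nbhd B x :&: nbhd B x'|)%:R * w x') / (lam + 1).
    under eq_bigr do rewrite mulrDr mulrA.
    rewrite big_split /= -mulr_suml -natr_card_nbhd -mulr_suml.
    under [X in _ + X / _ = _]eq_bigr do rewrite mulr_sumr.
    rewrite exchange_big /=; congr (_ + _ / _); apply: eq_bigr => x' _.
    by rewrite natr_card_nbhdI mulr_suml; apply: eq_bigr => y _; rewrite mulrA.
  apply: (mulIf lam_neq0).
  rewrite [RHS]mulrAC (sol x) /schur_kernel /outdeg /gram.
  under [X in _ = _ + X]eq_bigr do
    rewrite natrD mulrDl -mulrA [(#|W|%:R + _) * _]mulrDl.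
  rewrite !big_split /= -!mulr_sumr natrD /hadj.
  set a := \sum_x _; set b := \sum_x _; set c := \sum_x _.
  by field.
- rewrite /L_adj /=.
  under eq_bigr do rewrite mul1r.
  under [X in _ + (_ + X)]eq_bigr do rewrite orbF.
  rewrite (sum_natr_neq
    (fun y => lam + (\sum_x ((x, y) \in B)%:R * w x) / (lam + 1))).
  rewrite mul1r /defect -cl /=; set a := \sum_x _; set b := \sum_y _.
  by set c := \sum_x _; field.
Qed.
End Reduction.

(** * Comparison of spectral radii *)
Section RhoComparison.
Local Open Scope ring_scope.
Variables (R : realType) (W X Y : finType).
Hypothesis Y_gt0 : (0 < #|Y|)%N.
Implicit Types (H : sgraph X) (B : {set X * Y}).

Lemma vertices_gt0 : (0 < #|{: W + (X + Y)}|)%N.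
Proof. by rewrite !card_sum !addn_gt0 Y_gt0 !orbT. Qed.

Lemma card_Y_le_rho H B : #|Y|%:R - 1 <= rho R (L_graph W H B).
Proof.
pose v (u : W + (X + Y)) : R := if u is inr (inr _) then 1 else 0.
have supp (F : W + (X + Y) -> R) : \sum_u F u * v u = \sum_y F (inr (inr y)).
  rewrite !big_sumType /=.
  rewrite ![\sum_(i : W) _]big1 => [|i _]; last by rewrite mulr0.
  rewrite ![\sum_(i : X) _]big1 => [|i _]; last by rewrite mulr0.
  by rewrite !add0r; apply: eq_bigr => y _; rewrite mulr1.
have := rho_rayleigh (R := R) (L_graph W H B) vertices_gt0 v.
under eq_bigr do rewrite mulrC.
under [X in _ <= _ * X]eq_bigr do rewrite expr2.
rewrite !supp sum_const_natr mulr1.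
rewrite (eq_bigr (fun=> #|Y|%:R - 1)) => [|y _].
  by rewrite sum_const_natr mulrC ler_pM2r ?ltr0n.
rewrite supp -[#|Y|%:R]mulr1 -sum_const_natr -(sum_natr_neq (fun=> 1) y).
by apply: eq_bigr => t _; rewrite /= /L_adj /= orbF mulr1.
Qed.

(** Otherwise the sub-eigenvector lives on [X], where it cannot have growth
    factor larger than [#|X|]. *)
Lemma clique_mass_gt0 H B (u : W + (X + Y) -> R) :
  #|X|%:R < rho R (L_graph W H B) ->
  (forall v, 0 <= u v) -> (exists v, u v != 0) ->
  (forall v, rho R (L_graph W H B) * u v
             <= \sum_t (L_graph W H B v t)%:R * u t) ->
  0 < \sum_v (in_clique v)%:R * u v.
Proof.
move=> lamX u_ge0 [v uv0] sub.
have terms_ge0 t : 0 <= (in_clique t)%:R * u t by apply: mulr_ge0.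
rewrite lt0r sumr_ge0 // andbT; apply/negP => /eqP sum0.
have clique0 t : in_clique t -> u t = 0.
  move=> ct; have := psumr_eq0P (fun i _ => terms_ge0 i) sum0 (i := t) isT.
  by rewrite ct mul1r.
have [x ux_gt0] : exists x, 0 < u (inr (inl x)).
  case: v uv0 => [t|[x|t]] ux; try by rewrite clique0 ?eqxx in ux.
  by exists x; rewrite lt0r ux u_ge0.
pose x0 := [arg max_(x' > x) u (inr (inl x'))]%O.
have xmax x' : u (inr (inl x')) <= u (inr (inl x0)).
  by rewrite /x0; case: Order.TotalTheory.arg_maxP => // k _; apply.
have /lt_le_trans/(_ (xmax x)) x0_gt0 := ux_gt0.
have := sub (inr (inl x0)); rewrite !big_sumType /=.
rewrite [\sum_(i : W) _]big1 => [|i _]; last by rewrite clique0 ?mulr0.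
rewrite [\sum_(i : Y) _]big1 => [|i _]; last by rewrite clique0 ?mulr0.
rewrite add0r addr0 leNgt => /negP; apply.
apply: le_lt_trans (_ : #|X|%:R * u (inr (inl x0)) < _).
  rewrite -sum_const_natr; apply: ler_sum => x' _; rewrite -[leRHS]mul1r.
  by apply: ler_pM => //; case: (L_adj _ _ _ _).
by rewrite ltr_pM2r.
Qed.

(** Pairing with a sub-eigenvector shows that the defect of the first graph at
    its own spectral radius is nonnegative; the defect of the second one is
    then positive, and its extended vector has Rayleigh quotient above
    [lam]. *)
Lemma rho_lt_of_dot H B H' B' (w w' : X -> R) :
  let lam := rho R (L_graph W H B) in
  #|X|%:R < lam ->
  schur_solution lam (hadj H) (gram W B) (outdeg W B) w ->
  schur_solution lam (hadj H') (gram W B') (outdeg W B') w' ->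
  (forall x, 0 <= w x) -> (forall x, 0 <= w' x) ->
  \sum_x (outdeg W B x)%:R * w x < \sum_x (outdeg W B' x)%:R * w' x ->
  lam < rho R (L_graph W H' B').
Proof.
move=> lam lamX sol sol' w0 w0' dot_lt.
have lam_gt0 : 0 < lam by apply: le_lt_trans lamX.
have lam1_gt0 : 0 < lam + 1 by rewrite addr_gt0.
have lifted_ge0 B1 w1 : (forall x, 0 <= w1 x) ->
    forall v, 0 <= lifted (W := W) B1 lam w1 v.
  move=> w10 [t|[x|y]] //=; rewrite addr_ge0 ?divr_ge0 ?sumr_ge0 ?ltW // => x _.
  by rewrite mulr_ge0.
have [u [u_ge0 u_neq0 sub]] := rho_subeigen R (L_graph W H B) vertices_gt0.
have mass_gt0 := clique_mass_gt0 lamX u_ge0 u_neq0 sub.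
have eig := lifted_eigen lam1_gt0 sol.
have eig' := lifted_eigen lam1_gt0 sol'.
have defect_ge0 : 0 <= defect W B lam w.
  rewrite -(pmulr_lge0 _ mass_gt0).
  have : lam * \sum_v u v * lifted B lam w v
      <= \sum_v u v * \sum_t (L_graph W H B v t)%:R * lifted B lam w t.
    rewrite mulr_sumr.
    under [leRHS]eq_bigr do rewrite mulr_sumr.
    rewrite exchange_big /=; apply: ler_sum => v _.
    rewrite mulrA; apply: le_trans (ler_wpM2r (lifted_ge0 B w w0 v) (sub v)) _.
    rewrite mulr_suml; apply: ler_sum => t _.
    by rewrite (adj_sym (L_graph W H B) v t) mulrA (mulrC (u t)).
  under [leRHS]eq_bigr do rewrite eig mulrDr.
  rewrite big_split /= mulr_sumr.
  under eq_bigr do rewrite mulrCA.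
  rewrite lerDl mulr_sumr.
  by under eq_bigr do rewrite mulrA mulrC (mulrC (u _)).
have defect_gt0 : 0 < defect W B' lam w'.
  apply: (le_lt_trans defect_ge0); rewrite /defect ltrD2r ltrD2l.
  by rewrite ltr_pM2r ?invr_gt0.
(* A smaller spectral radius would contradict the Rayleigh bound for the
   extended vector of the second graph. *)
rewrite ltNge; apply/negP => rho_le.
have := rho_rayleigh (R := R) (L_graph W H' B') vertices_gt0 (lifted B' lam w').
under eq_bigr do rewrite eig' mulrDr mulrCA -expr2 mulrA.
rewrite big_split /= -mulr_sumr -mulr_suml leNgt => /negP; apply.
apply: (@le_lt_trans _ _ (lam * \sum_v lifted (W := W) B' lam w' v ^+ 2)).
  by apply: ler_wpM2r => //; apply: sumr_ge0 => v _; apply: sqr_ge0.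
rewrite ltrDl mulr_gt0 //.
have [y0 _] := card_gt0P Y_gt0.
rewrite (bigD1 (inr (inr y0))) //= mulr1 ltr_pwDl ?sumr_ge0 //.
  rewrite ltr_pwDl // divr_ge0 ?sumr_ge0 ?ltW // => x _; exact: mulr_ge0.
by move=> v _; rewrite mulr_ge0 // lifted_ge0.
Qed.

(** The lexicographic comparison of the first coefficients of [d . w] as a
    series in [1 / lam]. In the last case [H] is the same on both sides, which
    makes the other contributions of that order cancel. *)
Definition data_lt H B H' B' : Prop :=
  [\/ (\sum_x outdeg W B x ^ 2 < \sum_x outdeg W B' x ^ 2)%N,
      (\sum_x outdeg W B x ^ 2 = \sum_x outdeg W B' x ^ 2)%N /\
      (quad (hadj H) (outdeg W B) < quad (hadj H') (outdeg W B'))%N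
    | [/\ H = H', outdeg W B =1 outdeg W B' &
      (quad (gram W B) (outdeg W B) < quad (gram W B') (outdeg W B'))%N]].

Lemma L_bounded_data m H B : (forall x, #|nbhd B x| <= m)%N ->
  bounded_data (#|W| + m) (hadj H) (gram W B) (outdeg W B).
Proof.
move=> Bm; split=> [x y|x]; last by rewrite leq_add2l.
by rewrite leq_b1 leq_add2l (leq_trans _ (Bm x)) // subset_leq_card ?subsetIl.
Qed.

Lemma schur_solution_ext (lam : R) A N (d d' : X -> nat) w : d =1 d' ->
  schur_solution lam A N d w -> schur_solution lam A N d' w.
Proof. by move=> dd' sol x; rewrite -dd' sol. Qed.

Lemma rho_lt_of_data m H B H' B' :
  (threshold #|X| (#|W| + m))%:R <= rho R (L_graph W H B) ->
  (forall x, #|nbhd B x| <= m)%N -> (forall x, #|nbhd B' x| <= m)%N ->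
  data_lt H B H' B' -> rho R (L_graph W H B) < rho R (L_graph W H' B').
Proof.
move=> lam_ge Bm Bm' cmp.
have bd := L_bounded_data H Bm; have bd' := L_bounded_data H' Bm'.
have [w [sol near]] := schur_solution_exists lam_ge bd.
have [w' [sol' near']] := schur_solution_exists lam_ge bd'.
have near_ge0 d1 (w1 : X -> R) :
    near_data (#|W| + m) (rho R (L_graph W H B)) d1 w1 -> forall x, 0 <= w1 x.
  by move=> near1 x; have /andP[+ _] := near1 x; apply: le_trans.
apply: (rho_lt_of_dot _ sol sol'); try exact: near_ge0.
- have [lam1 lam2 _ _ _] := threshold_split lam_ge.
  have : (#|X| * 2)%N%:R <= (row_bound #|X| (#|W| + m))%:R :> R.
    by rewrite ler_nat leq_mul2l leq_addr orbT.
  by rewrite natrM; have := ler0n R #|X|; lra.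
case: cmp => [sq|[sq qd]|[eqH eqd qd]].
- exact: (dot_lt_of_sqnorm lam_ge bd near near').
- exact: (dot_lt_of_quad lam_ge bd sol sol' near near').
subst H'; under [X in _ < X]eq_bigr do rewrite -eqd.
apply: (dot_lt_of_gram lam_ge bd _ _ sol _ near _ _).
- by move=> x y; rewrite /hadj adj_sym.
- by move=> x y; rewrite /gram finset.setIC.
- exact: schur_solution_ext sol'.
- by move=> x; rewrite eqd.
move: qd; rewrite /quad; under [X in (_ < X)%N]eq_bigr => x _.
  rewrite -eqd; under eq_bigr do rewrite -eqd; over.
by [].
Qed.

End RhoComparison.

(** * Degrees and stars *)
Lemma eq_sum_leq (I : finType) (P : pred I) (F G : I -> nat) :
  (forall i, P i -> F i <= G i) -> \sum_(i | P i) G i <= \sum_(i | P i) F i ->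
  forall i, P i -> F i = G i.
Proof.
move=> FG GF i Pi; apply/eqP; rewrite eqn_leq FG //=.
move: GF; rewrite (bigD1 i) //= [X in _ <= X](bigD1 i) //=.
have : \sum_(j | P j && (j != i)) F j <= \sum_(j | P j && (j != i)) G j.
  by apply: leq_sum => j /andP[/FG].
by lia.
Qed.

Section Degrees.
Variables (T : finType) (M : sgraph T).

Lemma deg_sum x : deg M x = \sum_y M x y.
Proof.
rewrite /deg -sum1_card big_mkcond; apply: eq_bigr => y _.
by rewrite inE; case: (M x y).
Qed.

(** Every edge is the set of ends of exactly two ordered adjacent pairs. *)
Lemma handshake : \sum_x deg M x = 2 * #|edges M|.
Proof.
pose D := [set p : T * T | M p.1 p.2].
have -> : \sum_x deg M x = #|D|.
  rewrite -sum1_card (eq_bigl (fun p : T * T => M p.1 p.2)); last first.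
    by move=> p; rewrite inE.
  rewrite -(pair_big_dep xpredT (fun x y => M x y) (fun _ _ => 1)) /=.
  apply: eq_bigr => x _; rewrite deg_sum [RHS]big_mkcond.
  by apply: eq_bigr => y _; case: (M x y).
(* The blocks of [D] under the map to unordered pairs have size two. *)
pose ends (p : T * T) := [set p.1; p.2].
have edgesE : edges M = ends @: D.
  apply/setP=> e; apply/imsetP/imsetP => -[p pD ->];
  by exists p; rewrite ?inE // in pD *.
rewrite edgesE mulnC -sum_nat_const -sum1_card (partition_big_imset ends) /=.
apply: eq_bigr => e /imsetP[[x y]]; rewrite inE /= => Mxy ->.
have xy : x != y by apply: contraTneq Mxy => ->; rewrite adj_irr.
rewrite sum1dep_card (_ : [set _ | _] = [set (x, y); (y, x)]) ?cards2.
  by rewrite xpair_eqE negb_and xy.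
apply/setP=> -[u v]; rewrite !inE /ends /= !xpair_eqE.
apply/andP/orP => [[Muv /eqP/setP Euv]|[]/andP[/eqP-> /eqP->]]; last 2 first.
- by split.
- by split; [rewrite adj_sym | rewrite setUC].
have uv : u != v by apply: contraTneq Muv => ->; rewrite adj_irr.
have := Euv x; have := Euv y; rewrite !inE !eqxx ?orbT /=.
have := Euv u; have := Euv v; rewrite !inE !eqxx ?orbT /= => /esym Hv /esym Hu.
case/orP: Hu => /eqP Eu; case/orP: Hv => /eqP Ev; subst u v; rewrite ?eqxx in uv *;
  by [left|right].
Qed.

Lemma sum_adj_deg (F : T -> nat) :
  \sum_x \sum_y M x y * F x = \sum_x deg M x * F x.
Proof. by apply: eq_bigr => x _; rewrite deg_sum big_distrl. Qed.

Lemma sum_adj_degr (F : T -> nat) :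
  \sum_x \sum_y M x y * F y = \sum_x deg M x * F x.
Proof.
rewrite exchange_big -sum_adj_deg; apply: eq_bigr => x _; apply: eq_bigr => y _.
by rewrite adj_sym.
Qed.

Variable m : nat.
Hypothesis sum_deg : \sum_x deg M x = 2 * m.

(** At most one edge joins [x] and [y], so among the [m] edges at least
    [deg M x + deg M y - 1] meet [{x, y}]. The count is done on degrees: each
    other vertex has degree at least its number of neighbours in [{x, y}]. *)
Lemma deg_edge_le x y : M x y -> deg M x + deg M y <= m.+1.
Proof.
move=> Mxy; have xy : y != x by apply: contraTneq Mxy => ->; rewrite adj_irr.
have split (F : T -> nat) :
    \sum_z F z = F x + (F y + \sum_(z | (z != x) && (z != y)) F z).
  by rewrite (bigD1 x) //= (bigD1 y).
have low : \sum_(z | (z != x) && (z != y)) (M x z + M y z)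
    <= \sum_(z | (z != x) && (z != y)) deg M z.
  apply: leq_sum => z _; rewrite deg_sum (bigD1 x) //= (bigD1 y) //= addnA.
  by rewrite (adj_sym M x z) (adj_sym M y z) leq_addr.
have := sum_deg; rewrite split.
move: low; rewrite big_split /=.
have := split (fun z => M x z : nat); have := split (fun z => M y z : nat).
rewrite -!deg_sum !adj_irr (adj_sym M y x) Mxy; lia.
Qed.

Lemma sum_adj_const c : \sum_x \sum_y M x y * c = 2 * m * c.
Proof. by rewrite (sum_adj_deg (fun=> c)) -big_distrl sum_deg. Qed.

Lemma eq_on_edges (F G : T -> T -> nat) :
  (forall x y, M x y -> F x y <= G x y) ->
  \sum_x \sum_y M x y * G x y <= \sum_x \sum_y M x y * F x y ->
  forall x y, M x y -> F x y = G x y.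
Proof.
move=> FG; rewrite !pair_bigA /= => GF x y Mxy.
have := @eq_sum_leq _ xpredT (fun p => M p.1 p.2 * F p.1 p.2)
  (fun p => M p.1 p.2 * G p.1 p.2) _ GF (x, y) isT.
rewrite /= Mxy !mul1n; apply => -[u v] _ /=.
by case E: (M u v); rewrite ?mul0n // !mul1n FG.
Qed.

Lemma sum_sqdeg : 2 * \sum_x deg M x ^ 2
  = \sum_x \sum_y M x y * (deg M x + deg M y).
Proof.
under [RHS]eq_bigr do under eq_bigr do rewrite mulnDr.
under [RHS]eq_bigr do rewrite big_split.
by rewrite big_split /= sum_adj_deg sum_adj_degr addnn -mul2n.
Qed.

Lemma sqdeg_le : \sum_x deg M x ^ 2 <= m * m.+1.
Proof.
rewrite -(leq_pmul2l (isT : 0 < 2)) sum_sqdeg mulnA -sum_adj_const.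
apply: leq_sum => x _; apply: leq_sum => y _.
by case E: (M x y); rewrite ?mul1n ?mul0n // deg_edge_le.
Qed.

Lemma sqdeg_max : m * m.+1 <= \sum_x deg M x ^ 2 ->
  forall x y, M x y -> deg M x + deg M y = m.+1.
Proof.
rewrite -(leq_pmul2l (isT : 0 < 2)) sum_sqdeg mulnA -sum_adj_const.
exact: (eq_on_edges (F := fun x y => deg M x + deg M y) deg_edge_le).
Qed.

Lemma quad_hadj (d : T -> nat) :
  quad (hadj M) d = \sum_x \sum_y M x y * (d x * d y).
Proof.
apply: eq_bigr => x _; rewrite big_distrr /=; apply: eq_bigr => y _.
by rewrite /hadj mulnCA.
Qed.

Lemma deg_gt0 x y : M x y -> 0 < deg M x.
Proof. by move=> Mxy; apply/card_gt0P; exists y; rewrite inE. Qed.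

Lemma deg_prod_ge x y : M x y -> deg M x + deg M y = m.+1 ->
  m <= deg M x * deg M y.
Proof.
move=> Mxy; have := deg_gt0 Mxy; rewrite adj_sym in Mxy; have := deg_gt0 Mxy.
nia.
Qed.

(** With [deg M x + deg M y = m + 1] and both degrees positive, the product of
    the degrees is at least [m], and so the quadratic form is at least the
    bound, edge by edge. *)
Lemma quad_edge_min a :
  (forall x y, M x y -> deg M x + deg M y = m.+1) ->
  quad (hadj M) (fun x => a + deg M x) <= 2 * m * (a ^ 2 + a * m.+1 + m) ->
  forall x y, M x y -> deg M x * deg M y = m.
Proof.
move=> esum; rewrite quad_hadj -sum_adj_const => quad_le x y Mxy.
have quad_ge u v : M u v ->
    a ^ 2 + a * m.+1 + m <= (a + deg M u) * (a + deg M v).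
  move=> Muv; have := deg_prod_ge Muv (esum _ _ Muv).
  by have := esum _ _ Muv; nia.
have := eq_on_edges quad_ge quad_le Mxy; have := esum _ _ Mxy; nia.
Qed.

Definition star_at (c : T) : Prop := forall x y, M x y -> x = c \/ y = c.

Lemma deg_sumD c : deg M c = \sum_(x | x != c) M c x.
Proof. by rewrite deg_sum (bigD1 c) //= adj_irr. Qed.

Lemma star_deg c x : star_at c -> x != c -> deg M x = M c x.
Proof.
move=> cM xc; rewrite deg_sum (bigD1 c) //= adj_sym big1 ?addn0 // => y yc.
by apply/eqP; rewrite eqb0; apply/negP => /cM[] E; rewrite E eqxx in xc yc.
Qed.

Lemma star_deg_center c : star_at c -> deg M c = m.
Proof.
move=> cM; have := sum_deg; rewrite (bigD1 c) //=.
rewrite (eq_bigr (fun x => M c x : nat)) => [|x]; last exact: star_deg.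
rewrite -deg_sumD; lia.
Qed.

Lemma star_edge c x y : star_at c -> M x y ->
  deg M x + deg M y = m.+1 /\ deg M x * deg M y = m.
Proof.
move=> cM Mxy; have xy : x != y by apply: contraTneq Mxy => ->; rewrite adj_irr.
have [E|E] := cM _ _ Mxy; subst c.
  by rewrite (star_deg_center cM) (star_deg cM) 1?eq_sym // Mxy addn1 muln1.
by rewrite (star_deg_center cM) (star_deg cM) // adj_sym Mxy add1n mul1n.
Qed.

(** Sum [m + 1] and product [m] force the degrees [1] and [m]. Around a vertex
    [c] of degree [m], the remaining degrees sum to [m], which the neighbours
    of [c] already use up. *)
Lemma star_of_edge_degrees : 0 < m ->
  (forall x y, M x y -> deg M x + deg M y = m.+1) ->
  (forall x y, M x y -> deg M x * deg M y = m) ->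
  exists c, star_at c.
Proof.
move=> m_gt0 esum eprod.
have [x [y Mxy]] : exists x y, M x y.
  have /existsP[x] : [exists x, 0 < deg M x].
    rewrite -[X in is_true X]negbK negb_exists; apply/negP => /forallP deg0.
    by move: sum_deg; rewrite big1 => [|x _]; [lia | have := deg0 x; lia].
  by case/card_gt0P=> y; rewrite inE; exists x, y.
have [c deg_c] : exists c, deg M c = m.
  have := esum _ _ Mxy; have := eprod _ _ Mxy => Ep Es.
  have x_gt0 := deg_gt0 Mxy; rewrite adj_sym in Mxy; have y_gt0 := deg_gt0 Mxy.
  have : (deg M x - 1) * (deg M y - 1) = 0 by nia.
  by move/eqP; rewrite muln_eq0 => /orP[]/eqP ?; [exists y | exists x]; lia.
exists c => u v Muv; have [|uc] := eqVneq u c; first by left.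
have [|vc] := eqVneq v c; first by right.
have degE z : z != c -> (M c z : nat) = deg M z.
  move: z; apply: eq_sum_leq => [z zc|].
    by rewrite deg_sum (bigD1 c) //= adj_sym leq_addr.
  move: sum_deg; rewrite (bigD1 c) //= {1}deg_c.
  by rewrite -deg_sumD deg_c; lia.
have := degE u uc; rewrite deg_sum (bigD1 c) //= (bigD1 v) //= Muv adj_sym; lia.
Qed.

End Degrees.

(** * Extremality of the star and of its boundary *)
Section Extremal.
Variables (W X Y : finType) (m : nat).
Implicit Types (H : sgraph X) (B : {set X * Y}).
Local Notation a := #|W|.

Definition tight H B : Prop := forall x, #|nbhd B x| = deg (gcompl H) x.

Lemma outdeg_tight H B : tight H B ->
  outdeg W B =1 (fun x => a + deg (gcompl H) x).
Proof. by move=> HB x; rewrite /outdeg HB. Qed.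

Lemma eq_quad (Q : X -> X -> nat) d d' : d =1 d' -> quad Q d = quad Q d'.
Proof.
move=> dd'; apply: eq_bigr => x _; rewrite dd'; congr (_ * _).
by apply: eq_bigr => y _; rewrite dd'.
Qed.

Lemma sum_outdeg H B : tight H B -> \sum_x deg (gcompl H) x = 2 * m ->
  \sum_x outdeg W B x = #|X| * a + 2 * m.
Proof.
move=> HB sum_deg; rewrite (eq_bigr _ (fun x _ => outdeg_tight HB x)).
by rewrite big_split /= sum_deg sum_nat_const.
Qed.

Lemma sum_outdeg_sq H B : tight H B -> \sum_x deg (gcompl H) x = 2 * m ->
  \sum_x outdeg W B x ^ 2
  = #|X| * a ^ 2 + 4 * a * m + \sum_x deg (gcompl H) x ^ 2.
Proof.
move=> HB sum_deg; rewrite (eq_bigr (fun x => a ^ 2 + 2 * a * deg (gcompl H) x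
  + deg (gcompl H) x ^ 2)) => [|x _].
  rewrite !big_split /= sum_nat_const -big_distrr /= sum_deg.
  by congr (_ + _ + _); nia.
by rewrite (outdeg_tight HB); nia.
Qed.

(** The three terms add up to the all-ones form, since [x'] is equal to,
    adjacent to, or non-adjacent to [x]. *)
Lemma quad_compl H d : quad (hadj H) d + quad (hadj (gcompl H)) d
  + \sum_x d x ^ 2 = (\sum_x d x) ^ 2.
Proof.
rewrite -!big_split /= expnS expn1 big_distrl /=; apply: eq_bigr => x _.
rewrite -!mulnDr; congr (_ * _); rewrite -big_split /= -[d x]mul1n.
rewrite [X in _ + X = _](_ : _ = \sum_y (x == y) * d y); last first.
  rewrite (bigD1 x) //= eqxx big1 ?addn0 // => y; rewrite eq_sym.
  by move/negPf->.
rewrite -big_split /=; apply: eq_bigr => y _.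
rewrite -!mulnDl /hadj /= /compl_adj.
have [->|xy] := eqVneq x y; first by rewrite adj_irr mul1n.
by case: (H x y); rewrite mul1n.
Qed.

(** Double counting: a common neighbour [y] of [x] and [x'] contributes the
    product [d x * d x']. *)
Lemma quad_gram B d : quad (gram W B) d
  = a * (\sum_x d x) ^ 2 + \sum_y (\sum_x ((x, y) \in B) * d x) ^ 2.
Proof.
have -> : \sum_y (\sum_x ((x, y) \in B) * d x) ^ 2
    = \sum_x d x * \sum_x' #|nbhd B x :&: nbhd B x'| * d x'.
  transitivity (\sum_y \sum_x \sum_x'
      ((x, y) \in B) * ((x', y) \in B) * (d x * d x')).
    apply: eq_bigr => y _; rewrite expnS expn1 big_distrl /=.
    apply: eq_bigr => x _; rewrite big_distrr /=; apply: eq_bigr => x' _.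
    by lia.
  rewrite exchange_big /=; apply: eq_bigr => x _.
  rewrite exchange_big big_distrr /=; apply: eq_bigr => x' _.
  rewrite -big_distrl /= mulnCA; congr (_ * (_ * _)).
  rewrite -sum1_card [RHS]big_mkcond; apply: eq_bigr => y _; rewrite !inE.
  by do 2!case: (_ \in B).
rewrite expnS expn1 {1}big_distrl /= big_distrr /= -big_split /=.
apply: eq_bigr => x _; rewrite mulnCA -mulnDr; congr (_ * _).
rewrite big_distrr /= -big_split /=; apply: eq_bigr => x' _.
by rewrite -mulnDl.
Qed.

(** A star realizes both extreme values, so a graph that does not lose at the
    first two steps attains them as well, and is a star. *)
Lemma data_lt_or_star H B H' B' c' : 0 < m ->
  tight H B -> tight H' B' ->
  \sum_x deg (gcompl H) x = 2 * m -> \sum_x deg (gcompl H') x = 2 * m ->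
  star_at (gcompl H') c' ->
  data_lt W H B H' B' \/ exists c, star_at (gcompl H) c.
Proof.
move=> m_gt0 HB HB' sumH sumH' star'.
have edge' x y (E : gcompl H' x y) := star_edge sumH' star' E.
have sq' : \sum_x deg (gcompl H') x ^ 2 = m * m.+1.
  apply/eqP; rewrite eqn_leq sqdeg_le //= -(leq_pmul2l (isT : 0 < 2)) sum_sqdeg.
  rewrite mulnA -(sum_adj_const sumH').
  apply: leq_sum => x _; apply: leq_sum => y _; case E: (gcompl H' x y) => //.
  by have [-> _] := edge' x y E.
have quad' : quad (hadj (gcompl H')) (fun x => a + deg (gcompl H') x)
    = 2 * m * (a ^ 2 + a * m.+1 + m).
  rewrite quad_hadj -(sum_adj_const sumH').
  apply: eq_bigr => x _; apply: eq_bigr => y _; case E: (gcompl H' x y) => //.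
  by have [? ?] := edge' x y E; congr (_ * _); nia.
have sqE := sum_outdeg_sq HB sumH; have sqE' := sum_outdeg_sq HB' sumH'.
have [sq_lt|sq_ge] := ltnP (\sum_x deg (gcompl H) x ^ 2) (m * m.+1).
  by left; apply: Or31; rewrite sqE sqE' sq' ltn_add2l.
have esum := sqdeg_max sumH sq_ge.
have sq : \sum_x deg (gcompl H) x ^ 2 = m * m.+1.
  by apply/eqP; rewrite eqn_leq sq_ge sqdeg_le.
have sq_eq : \sum_x outdeg W B x ^ 2 = \sum_x outdeg W B' x ^ 2.
  by rewrite sqE sqE' sq sq'.
have := quad_compl H (outdeg W B); have := quad_compl H' (outdeg W B').
rewrite (sum_outdeg HB sumH) (sum_outdeg HB' sumH') sq_eq => <-.
rewrite !(eq_quad _ (outdeg_tight HB)) !(eq_quad _ (outdeg_tight HB')) quad'.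
have [q_le|q_gt] := leqP (quad (hadj (gcompl H)) (fun x => a + deg (gcompl H) x))
  (2 * m * (a ^ 2 + a * m.+1 + m)).
  move=> _; right.
  exact: (star_of_edge_degrees sumH m_gt0 esum (quad_edge_min sumH esum q_le)).
move=> E; left; apply: Or32; split=> //.
rewrite !(eq_quad _ (outdeg_tight HB)) !(eq_quad _ (outdeg_tight HB')); lia.
Qed.

Definition star_form (c : X) (y1 : Y) H B : Prop :=
  [/\ star_at (gcompl H) c, (c, y1) \in B
    & forall x y, x != c -> ((x, y) \in B) = gcompl H c x && (y == y1)].

Definition leaf_load c B (y : Y) : nat := \sum_(x | x != c) ((x, y) \in B).

Lemma card_nbhd B x : #|nbhd B x| = \sum_y ((x, y) \in B).
Proof.
rewrite -sum1_card big_mkcond; apply: eq_bigr => y _.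
by rewrite inE; case: (_ \in B).
Qed.

Section StarBoundary.
Variables (H : sgraph X) (c : X).
Hypotheses (m_gt0 : 0 < m) (sumH : \sum_x deg (gcompl H) x = 2 * m)
  (cH : star_at (gcompl H) c).
Implicit Types (b : {set X * Y}).

Lemma sum_center b : tight H b -> \sum_y ((c, y) \in b) = m.
Proof. by move=> /(_ c); rewrite card_nbhd (star_deg_center sumH). Qed.

Lemma sum_leaf_load b : tight H b -> \sum_y leaf_load c b y = m.
Proof.
move=> Hb; rewrite exchange_big /=.
rewrite (eq_bigr (fun x => deg (gcompl H) x)) => [|x _].
  have := sumH; rewrite (bigD1 c) //= (star_deg_center sumH cH); lia.
by rewrite -card_nbhd.
Qed.

(** A non-central vertex with a neighbour in [Y] is a leaf, so it has weight
    [a + 1]. *)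
Lemma boundary_weight b y : tight H b ->
  \sum_x ((x, y) \in b) * outdeg W b x
  = ((c, y) \in b) * (a + m) + leaf_load c b y * (a + 1).
Proof.
move=> Hb; rewrite (bigD1 c) //= (outdeg_tight Hb) (star_deg_center sumH cH).
congr (_ + _); rewrite big_distrl /=; apply: eq_bigr => x xc.
case E: (_ \in b); rewrite // (outdeg_tight Hb) (star_deg cH xc).
suff -> : gcompl H c x by [].
have : 0 < #|nbhd b x| by apply/card_gt0P; exists y; rewrite inE.
by rewrite Hb (star_deg cH xc) lt0b.
Qed.

Definition center_load b := \sum_y ((c, y) \in b) * leaf_load c b y.
Definition sq_load b := \sum_y leaf_load c b y ^ 2.

(** Expansion of the squares of [boundary_weight]: only [center_load] and
    [sq_load] depend on the way the boundary edges are placed. *)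
Lemma quad_gram_star b : tight H b ->
  quad (gram W b) (outdeg W b)
  = a * (#|X| * a + 2 * m) ^ 2 + m * (a + m) ^ 2
    + 2 * (a + m) * (a + 1) * center_load b + (a + 1) ^ 2 * sq_load b.
Proof.
move=> Hb; rewrite quad_gram (sum_outdeg Hb sumH) -!addnA; congr (_ + _).
rewrite (eq_bigr (fun y => ((c, y) \in b) * (a + m) ^ 2
  + (2 * (a + m) * (a + 1) * (((c, y) \in b) * leaf_load c b y)
  + (a + 1) ^ 2 * leaf_load c b y ^ 2))) => [|y _].
  by rewrite !big_split /= -big_distrl /= (sum_center Hb) -!big_distrr.
rewrite (boundary_weight y Hb); case: (_ \in b) => /=; nia.
Qed.

Lemma center_load_le b : tight H b -> center_load b <= m.
Proof.
move=> Hb; rewrite -(sum_leaf_load Hb); apply: leq_sum => y _.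
by case: (_ \in b); rewrite ?mul1n.
Qed.

Lemma leaf_load_le b y : tight H b -> leaf_load c b y <= m.
Proof. by move=> Hb; rewrite -(sum_leaf_load Hb) (bigD1 y) //= leq_addr. Qed.

Lemma sq_load_le b : tight H b -> sq_load b <= m ^ 2.
Proof.
move=> Hb; rewrite -[m ^ 2]mulnn -{2}(sum_leaf_load Hb) big_distrr /=.
apply: leq_sum => y _; rewrite expnS expn1 leq_mul2r leaf_load_le //.
by rewrite orbT.
Qed.

Lemma star_form_load b y1 y : tight H b -> star_form c y1 H b ->
  leaf_load c b y = m * (y == y1).
Proof.
move=> Hb [_ _ leafE]; have := sum_leaf_load Hb; rewrite (bigD1 y1) //=.
have off z : z != y1 -> leaf_load c b z = 0.
  move=> /negPf zy; rewrite /leaf_load big1 // => x xc.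
  by rewrite leafE // zy andbF.
rewrite big1 ?addn0 => [<-|z /off //].
by have [->|/off ->] := eqVneq y y1; rewrite ?muln1 ?muln0.
Qed.

Lemma star_form_loads b y1 : tight H b -> star_form c y1 H b ->
  center_load b = m /\ sq_load b = m ^ 2.
Proof.
move=> Hb Sb; have [_ cy1 _] := Sb.
rewrite /center_load /sq_load (bigD1 y1) //= [X in _ /\ X = _](bigD1 y1) //=.
rewrite !big1 => [|z /negPf zy|z /negPf zy].
- by rewrite !(star_form_load _ Hb Sb) eqxx cy1 !addn0 mul1n muln1.
- by rewrite (star_form_load _ Hb Sb) zy muln0.
- by rewrite (star_form_load _ Hb Sb) zy !muln0.
Qed.

(** Equality in [sq_load_le] forces each load to be [0] or [m], hence a single
    loaded vertex [y1]; equality in [center_load_le] makes it a neighbour of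
    [c]. *)
Lemma star_form_of_loads b : tight H b -> m <= center_load b ->
  m ^ 2 <= sq_load b -> exists y1, star_form c y1 H b.
Proof.
move=> Hb cload sload.
have [y1 load1] : exists y1, 0 < leaf_load c b y1.
  have /existsP[y] : [exists y, 0 < leaf_load c b y].
    rewrite -[X in is_true X]negbK negb_exists; apply/negP => /forallP load0.
    have := sum_leaf_load Hb; rewrite big1 => [|y _]; first by lia.
    by have := load0 y; lia.
  by exists y.
have sqE y : leaf_load c b y ^ 2 = m * leaf_load c b y.
  apply: (@eq_sum_leq _ xpredT (fun y => leaf_load c b y ^ 2)
    (fun y => m * leaf_load c b y) _ _ y isT) => [z _|].
    by rewrite expnS expn1 leq_mul2r leaf_load_le ?orbT.
  by rewrite -big_distrr /= (sum_leaf_load Hb) mulnn.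
have centerE y : ((c, y) \in b) * leaf_load c b y = leaf_load c b y.
  apply: (@eq_sum_leq _ xpredT (fun y => ((c, y) \in b) * leaf_load c b y)
    (leaf_load c b) _ _ y isT) => [z _|].
    by case: (_ \in b); rewrite ?mul1n.
  by rewrite (sum_leaf_load Hb).
have load1E : leaf_load c b y1 = m by have := sqE y1; nia.
have off y : y != y1 -> leaf_load c b y = 0.
  move=> yy1; have := sum_leaf_load Hb; rewrite (bigD1 y1) //= load1E.
  by rewrite (bigD1 y) //=; lia.
have cy1 : (c, y1) \in b by have := centerE y1; case: (_ \in b) => //; lia.
exists y1; split=> // x y xc.
have only z : (x, z) \in b -> z = y1.
  move=> xz; apply/eqP; apply: contraTT xz => /off.
  by rewrite /leaf_load (bigD1 x) //=; case: (_ \in b).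
have := Hb x.
rewrite (star_deg cH xc) card_nbhd (bigD1 y1) //= big1 => [|z zy1].
  rewrite addn0; have [->|yy1] := eqVneq y y1; rewrite ?andbT ?andbF.
    by case: (_ \in b); case: (compl_adj H c x).
  by move=> _; apply: contraNF yy1 => /only ->.
by apply/eqP; rewrite eqb0; apply: contra zy1 => /only ->.
Qed.

Lemma data_lt_or_star_form b b' y1 : tight H b -> tight H b' ->
  star_form c y1 H b' ->
  data_lt W H b H b' \/ exists y2, star_form c y2 H b.
Proof.
move=> Hb Hb' Sb'; have [cE sE] := star_form_loads Hb' Sb'.
have [le_c|lt_c] := leqP m (center_load b); last first.
  left; apply: Or33; split=> // [x|].
    by rewrite (outdeg_tight Hb) (outdeg_tight Hb').
  rewrite !quad_gram_star // cE sE; have := sq_load_le Hb.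
  by have := leq0n a; nia.
have [le_s|lt_s] := leqP (m ^ 2) (sq_load b).
  by right; apply: star_form_of_loads.
left; apply: Or33; split=> // [x|].
  by rewrite (outdeg_tight Hb) (outdeg_tight Hb').
rewrite !quad_gram_star // cE sE; have := center_load_le Hb.
by have := leq0n a; nia.
Qed.

Lemma star_form_exists b : tight H b ->
  exists b' y1, tight H b' /\ star_form c y1 H b'.
Proof.
move=> Hb; have [y1] : exists y, y \in nbhd b c.
  by apply/card_gt0P; rewrite Hb (star_deg_center sumH).
rewrite inE => cy1.
pose b' := [set p | if p.1 == c then p \in b
                    else gcompl H c p.1 && (p.2 == y1)].
exists b', y1; split; last first.
  by split=> // [|x y /negPf xc]; rewrite inE /= ?eqxx // xc.
move=> x; have [->|xc] := eqVneq x c.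
  by rewrite -Hb; apply: eq_card => y; rewrite !inE /= eqxx.
rewrite (star_deg cH xc) card_nbhd (bigD1 y1) //= inE /= (negPf xc) eqxx andbT.
by rewrite big1 ?addn0 // => y /negPf yy1; rewrite inE /= (negPf xc) yy1 andbF.
Qed.

End StarBoundary.

End Extremal.

(** * Isomorphism of the extremal shapes *)
Lemma L_graph_iso (W X Y : finType) (H H' : sgraph X) (B B' : {set X * Y})
    (f : {perm X}) (g : {perm Y}) :
  (forall x x', H' (f x) (f x') = H x x') ->
  (forall x y, ((f x, g y) \in B') = ((x, y) \in B)) ->
  isomorphic (L_graph W H B) (L_graph W H' B').
Proof.
move=> fH fB.
exists (fun u => match u with
  | inl t => inl t | inr (inl x) => inr (inl (f x))
  | inr (inr y) => inr (inr (g y)) end).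
split.
  exists (fun u => match u with
    | inl t => inl t | inr (inl x) => inr (inl (f^-1%g x))
    | inr (inr y) => inr (inr (g^-1%g y)) end);
  by case=> [t|[x|y]]; rewrite ?permK ?permKV.
case=> [t|[x|y]] [t'|[x'|y']]; rewrite /= /L_adj /= ?fH ?fB //.
by rewrite (inj_eq perm_inj).
Qed.

Lemma perm_of_classes n (f g : 'I_n -> nat) :
  (forall k, #|[set i | f i == k]| = #|[set i | g i == k]|) ->
  exists s : {perm 'I_n}, forall i, g (s i) = f i.
Proof.
move=> fg; have count_class (h : 'I_n -> nat) k :
    count_mem k [tuple h i | i < n] = #|[set i | h i == k]|.
  by rewrite count_map cardsE cardE size_filter -enumT.
have /tuple_permP[s E] : perm_eq [tuple f i | i < n] [tuple g i | i < n].
  by apply/allP=> k _ /=; rewrite !count_class fg.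
exists s => i; have /(congr1 (fun t => tnth t i)) := val_inj E.
by rewrite !tnth_mktuple.
Qed.

(** Both situations are recorded by class functions, with value [2] at the
    marked point, [1] on the set and [0] elsewhere, whose classes have equal
    sizes. *)
Lemma perm_marked n (c c' : 'I_n) (L L' : {set 'I_n}) :
  c \notin L -> c' \notin L' -> #|L| = #|L'| ->
  exists s : {perm 'I_n}, s c = c' /\ forall i, (s i \in L') = (i \in L).
Proof.
move=> cL cL' LL'.
pose rank (d : 'I_n) (K : {set 'I_n}) i := if i == d then 2 else (i \in K : nat).
have class2 d K : [set i | rank d K i == 2] = [set d].
  by apply/setP=> i; rewrite !inE /rank; case: (i == d); case: (i \in K).
have class1 (d : 'I_n) (K : {set 'I_n}) :
    d \notin K -> [set i | rank d K i == 1] = K.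
  move=> dK; apply/setP=> i; rewrite !inE /rank.
  by have [->|_] := eqVneq i d; [rewrite (negPf dK) | case: (i \in K)].
have class0 (d : 'I_n) (K : {set 'I_n}) : [set i | rank d K i == 0] = ~: (d |: K).
  by apply/setP=> i; rewrite !inE /rank; case: (i == d); case: (i \in K).
have class3 (d : 'I_n) (K : {set 'I_n}) k : [set i | rank d K i == k.+3] = set0.
  by apply/setP=> i; rewrite !inE /rank; case: (i == d); case: (i \in K).
have [|s sP] := @perm_of_classes n (rank c L) (rank c' L').
  case=> [|[|[|k]]].
  - apply/eqP; rewrite !class0 -(eqn_add2l #|c |: L|) cardsC !cardsU1 cL LL'.
    by rewrite -(cardsC (c' |: L')) cardsU1 cL'.
  - by rewrite !class1.
  - by rewrite !class2 !cards1.
  by rewrite !class3.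
have sc i : (s i == c') = (i == c).
  have := sP i; rewrite /rank; case: (i == c); case: (s i == c') => //.
    by case: (s i \in L').
  by case: (i \in L).
exists s; split; first by apply/eqP; rewrite sc.
move=> i; have [E|ic] := eqVneq i c.
  have := sc i; rewrite E eqxx => /eqP ->.
  by rewrite (negPf cL) (negPf cL').
have := sP i; rewrite /rank sc (negPf ic).
by do 2!case: (_ \in _).
Qed.

Lemma gcomplK (T : finType) (G : sgraph T) x y : gcompl (gcompl G) x y = G x y.
Proof.
rewrite /= /compl_adj /= /compl_adj negb_and negbK.
by have [->|] := eqVneq x y; rewrite ?adj_irr //= negbK.
Qed.

(** Adjacency is determined by the roles of the vertices (centre, leaf or
    isolated in [X]; [y1], another neighbour of the centre, or neither in [Y]),
    and the roles occur equally often in both graphs. *)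
Lemma star_form_iso (W : finType) p r m (H H' : sgraph 'I_p)
    (B B' : {set 'I_p * 'I_r}) c c' y1 y1' :
  \sum_x deg (gcompl H) x = 2 * m -> \sum_x deg (gcompl H') x = 2 * m ->
  tight H B -> tight H' B' -> star_form c y1 H B -> star_form c' y1' H' B' ->
  isomorphic (L_graph W H B) (L_graph W H' B').
Proof.
move=> sumH sumH' HB HB' [cH cy leaf] [cH' cy' leaf'].
have [f [fc fL]] : exists f : {perm 'I_p}, f c = c' /\
    forall x, (f x \in [set x | gcompl H' c' x]) = (x \in [set x | gcompl H c x]).
  apply: perm_marked; rewrite ?inE ?adj_irr //.
  exact: etrans (star_deg_center sumH cH) (esym (star_deg_center sumH' cH')).
have [g [gy gL]] : exists g : {perm 'I_r}, g y1 = y1' /\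
    forall y, (g y \in nbhd B' c' :\ y1') = (y \in nbhd B c :\ y1).
  apply: perm_marked; rewrite ?inE ?eqxx //.
  have := cardsD1 y1 (nbhd B c); have := cardsD1 y1' (nbhd B' c').
  rewrite !inE cy cy' HB HB' (star_deg_center sumH cH).
  by rewrite (star_deg_center sumH' cH') => -> [].
have fcE x : (f x == c') = (x == c) by rewrite -fc (inj_eq perm_inj).
have gyE y : (g y == y1') = (y == y1) by rewrite -gy (inj_eq perm_inj).
have leafE x : gcompl H' c' (f x) = gcompl H c x by have := fL x; rewrite !inE.
have starE (K : sgraph 'I_p) d : star_at (gcompl K) d -> forall x x',
    gcompl K x x' = (x == d) && gcompl K d x' || (x' == d) && gcompl K d x.
  move=> dK x x'; have [->|xd] := eqVneq x d.
    by rewrite adj_irr andbF orbF.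
  have [->|xd'] := eqVneq x' d; first by rewrite adj_sym.
  by apply/negP => /dK[] E; rewrite E eqxx in xd xd'.
apply: (@L_graph_iso _ _ _ _ _ _ _ f g) => [x x'|x y].
  rewrite -[LHS]gcomplK -[RHS]gcomplK /= /compl_adj (inj_eq perm_inj).
  by rewrite (starE _ _ cH') (starE _ _ cH) !fcE !leafE.
have [->|xc] := eqVneq x c; last by rewrite leaf' ?fcE // leaf // leafE gyE.
rewrite fc; have [->|yy] := eqVneq y y1; first by rewrite gy cy cy'.
by have := gL y; rewrite !inE gyE yy.
Qed.

(** * The extremal graph *)
Lemma N_YE (W X Y : finType) (H : sgraph X) (B : {set X * Y}) x :
  N_Y W H B x = nbhd B x.
Proof. by apply/setP=> y; rewrite !inE. Qed.

Lemma card_boundary (X Y : finType) (B : {set X * Y}) :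
  #|B| = \sum_x #|nbhd B x|.
Proof.
rewrite -sum1_card big_mkcond /=; under [RHS]eq_bigr do rewrite card_nbhd.
rewrite pair_bigA /=; apply: eq_bigr => -[x y] _ /=; by case: (_ \in B).
Qed.

Lemma card_ord_lt n h : h <= n -> #|[set i : 'I_n | i < h]| = h.
Proof.
move=> hn; have widen_inj : injective (widen_ord hn).
  by move=> i j /(congr1 val) /= /val_inj.
rewrite -[RHS]card_ord -(card_imset _ widen_inj).
apply: eq_card => i; rewrite inE; apply/idP/imsetP => [ih|[j _ ->] /=].
  by exists (Ordinal ih) => //; apply: val_inj.
exact: ltn_ord.
Qed.

Lemma deg_compl (T : finType) (G : sgraph T) x :
  deg G x + deg (gcompl G) x = #|T|.-1.
Proof.
rewrite !deg_sum -big_split /= (eq_bigr (fun y => (y != x) : nat)) => [|y _].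
  rewrite -(cardC1 x) -sum1_card [RHS]big_mkcond; apply: eq_bigr => y _.
  by rewrite inE /=; case: (y == x).
rewrite /compl_adj eq_sym; have [->|] := eqVneq y x; rewrite ?adj_irr //.
by case: (G x y).
Qed.

Lemma edges_compl (T : finType) (G : sgraph T) :
  #|edges G| + #|edges (gcompl G)| = 'C(#|T|, 2).
Proof.
have := handshake G; have := handshake (gcompl G) => E1 E2.
have : \sum_x (deg G x + deg (gcompl G) x) = #|T| * #|T|.-1.
  by rewrite (eq_bigr _ (fun x _ => deg_compl G x)) sum_nat_const.
rewrite big_split /= E1 E2 bin2 => <-.
by rewrite -mulnDr mul2n doubleK.
Qed.

Section ExtremalGraph.
Variable h : nat.

Definition star_adj (x y : Xtype h) : bool :=
  ((x == 0 :> nat) && (0 < y <= h)) || ((y == 0 :> nat) && (0 < x <= h)).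

Lemma star_adj_sym : symmetric star_adj.
Proof. by move=> x y; rewrite /star_adj orbC. Qed.

Lemma star_adj_irr : irreflexive star_adj.
Proof. by move=> x; rewrite /star_adj; lia. Qed.

Definition extremal_H : sgraph (Xtype h) :=
  gcompl (SGraph star_adj_sym star_adj_irr).

Lemma extremal_M x y : gcompl extremal_H x y = star_adj x y.
Proof. exact: gcomplK. Qed.

Lemma Xtype_gt0 : 0 < 2 * h + 2. Proof. by lia. Qed.
Definition center : Xtype h := Ordinal Xtype_gt0.

Lemma extremal_star : star_at (gcompl extremal_H) center.
Proof.
move=> x y; rewrite extremal_M => /orP[]/andP[/eqP E _]; [left|right];
exact: val_inj.
Qed.

Lemma extremal_deg_center : deg (gcompl extremal_H) center = h.
Proof.
rewrite /deg; transitivity #|[set i : Xtype h | i < h.+1] :\ center|.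
  apply: eq_card => y; rewrite !inE extremal_M /star_adj /= -val_eqE /=; lia.
have := cardsD1 center [set i : Xtype h | i < h.+1].
by rewrite card_ord_lt ?inE /=; lia.
Qed.

Lemma extremal_sum_deg : \sum_x deg (gcompl extremal_H) x = 2 * h.
Proof.
rewrite (bigD1 center) //= (eq_bigr (fun x => gcompl extremal_H center x : nat)).
  by rewrite -deg_sumD extremal_deg_center; lia.
by move=> x; apply: star_deg extremal_star.
Qed.

Lemma extremal_connected : gconnected extremal_H.
Proof.
(* The last vertex is isolated in the star, hence adjacent to all others. *)
have last_lt : 2 * h + 1 < 2 * h + 2 by lia.
have to_last x : connect extremal_H x (Ordinal last_lt).
  have [->|xl] := eqVneq x (Ordinal last_lt); first exact: connect0.
  apply: connect1; rewrite /= /compl_adj xl /= /star_adj /=; lia.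
move=> x y; apply: connect_trans (to_last x) _.
by rewrite (sym_connect_sym (adj_sym extremal_H)).
Qed.

Variable r : nat.
Hypothesis r_gt0 : 0 < r.

Definition extremal_B : {set Xtype h * 'I_r} :=
  [set p : Xtype h * 'I_r | if p.1 == 0 :> nat then p.2 < h
           else (p.1 <= h) && (p.2 == 0 :> nat)].

Definition first_Y : 'I_r := Ordinal r_gt0.

Lemma extremal_nbhd_center : nbhd extremal_B center = [set i : 'I_r | i < h].
Proof. by apply/setP=> y; rewrite !inE. Qed.

Lemma extremal_nbhd_leaf (x : Xtype h) :
  0 < x <= h -> nbhd extremal_B x = [set first_Y].
Proof.
by move=> xh; apply/setP=> y; rewrite !inE /= -val_eqE /=; case: eqP => ?; lia.
Qed.

Lemma extremal_star_form :
  0 < h -> star_form center first_Y extremal_H extremal_B.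
Proof.
move=> h_gt0; split=> [||x y xc]; first exact: extremal_star.
  by rewrite inE.
have x0 : 0 < x by rewrite lt0n; apply: contra_neq xc => ?; apply: val_inj.
by rewrite extremal_M inE /star_adj /= (gtn_eqF x0) -val_eqE /=; lia.
Qed.

Hypothesis hr : h <= r.

Lemma extremal_tight : tight extremal_H extremal_B.
Proof.
move=> x; have [->|xc] := eqVneq x center.
  by rewrite extremal_nbhd_center extremal_deg_center card_ord_lt.
rewrite (star_deg extremal_star xc) extremal_M /star_adj /=.
have x0 : 0 < x by rewrite lt0n; apply: contra_neq xc => ?; apply: val_inj.
have [xh|xh] := leqP x h.
  by rewrite extremal_nbhd_leaf ?cards1; lia.
rewrite (_ : nbhd _ _ = set0) ?cards0; first by lia.
by apply/setP=> y; rewrite !inE /=; case: eqP => ?; lia.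
Qed.

End ExtremalGraph.

(** * The family and the maximizer *)
Lemma deg_L_graph (W X Y : finType) (H : sgraph X) (B : {set X * Y}) x :
  deg (L_graph W H B) (inr (inl x)) = #|W| + deg H x + #|nbhd B x|.
Proof.
rewrite !deg_sum !big_sumType /= card_nbhd addnA /L_adj /= sum1_card.
by congr (_ + _ + _); apply: eq_bigr => y _; rewrite orbF.
Qed.

Section Family.
Variables n k delta : nat.
Hypotheses (hd1 : k <= delta) (hd2 : delta <= 2 * k - 1) (hk : 2 <= k).
Local Notation h := (delta - k).

Lemma deg_bound_tight (H : sgraph (Xtype h))
    (B : {set Xtype h * Ytype n k h}) x :
  (delta <= deg (L_graph (Wtype k h) H B) (inr (inl x)))
  = (deg (gcompl H) x <= #|nbhd B x|).
Proof.
rewrite deg_L_graph /Wtype card_ord; have := deg_compl H x.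
by rewrite card_ord; lia.
Qed.

(** The vertex conditions bound [#|nbhd B x|] below by the missing degree, and
    both have sum [2h]. *)
Lemma L_dataP (H : sgraph (Xtype h)) (B : {set Xtype h * Ytype n k h}) :
  L_data H B <->
  [/\ gconnected H, \sum_x deg (gcompl H) x = 2 * h & tight H B].
Proof.
have binE : 'C(2 * h + 2, 2) = h.+1 * (2 * h + 1).
  rewrite bin2 -[RHS]doubleK; congr (_./2); rewrite -mul2n; nia.
have hC : h <= 'C(2 * h + 2, 2) by rewrite binE; nia.
have edgesC := edges_compl H; rewrite card_ord in edgesC.
split=> [[conn edgesH cardB degH]|[conn sumM HB]].
  have sumM : \sum_x deg (gcompl H) x = 2 * h by rewrite handshake; lia.
  split=> // x; apply/esym.
  apply: (@eq_sum_leq _ xpredT (deg (gcompl H)) (fun x => #|nbhd B x|) _ _ x isT).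
    by move=> z _; rewrite -deg_bound_tight.
  by rewrite -card_boundary cardB sumM.
have edgesM : #|edges (gcompl H)| = h by move: sumM; rewrite handshake; lia.
split=> //; first by lia.
  by rewrite card_boundary (eq_bigr _ (fun x _ => HB x)).
by move=> x; rewrite /= deg_bound_tight HB.
Qed.

Hypotheses (r_gt0 : 0 < n - k - h - 1) (hr : h <= n - k - h - 1).
Local Notation Hs := (extremal_H h).
Local Notation Bs := (extremal_B h (n - k - h - 1)).
Local Notation Gs := (L_graph (Wtype k h) Hs (Bs : {set Xtype h * Ytype n k h})).

Lemma extremal_L_data : L_data (n := n) (k := k) (delta := delta) Hs Bs.
Proof.
apply/L_dataP; split; first exact: extremal_connected.
  exact: extremal_sum_deg.
exact: extremal_tight.
Qed.

Lemma L_iso_h0 (H : sgraph (Xtype h)) (B : {set Xtype h * Ytype n k h}) :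
  h = 0 -> L_data H B -> isomorphic (L_graph (Wtype k h) H B) Gs.
Proof.
move=> h0 /L_dataP[_ sumM HB].
have no_missing (K : sgraph (Xtype h)) : \sum_x deg (gcompl K) x = 2 * h ->
    forall x, deg (gcompl K) x = 0.
  rewrite [in 2 * h]h0 muln0 => /eqP; rewrite sum_nat_eq0 => /forallP E x.
  exact/eqP/(E x).
have complete_adj (K : sgraph (Xtype h)) : \sum_x deg (gcompl K) x = 2 * h ->
    forall x y, K x y = (x != y).
  move=> /no_missing E x y; have [->|xy] := eqVneq x y.
    by rewrite adj_irr.
  apply/negPn/negP => Kxy; have : gcompl K x y by rewrite /= /compl_adj xy.
  by move/deg_gt0; rewrite E.
have B0 (K : sgraph (Xtype h)) (C : {set Xtype h * Ytype n k h}) :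
    \sum_x deg (gcompl K) x = 2 * h -> tight K C ->
    forall x y, ((x, y) \in C) = false.
  move=> /no_missing E KC x y; have := KC x; rewrite E => /eqP.
  by rewrite cards_eq0 => /eqP/setP/(_ y); rewrite !inE.
have sumS := extremal_sum_deg h; have tightS := extremal_tight r_gt0 hr.
apply: (@L_graph_iso _ _ _ _ _ _ _ 1%g 1%g) => [x y|x y]; rewrite !perm1.
  by rewrite !complete_adj.
by rewrite (B0 _ _ sumM HB) (B0 _ _ sumS tightS).
Qed.

Variable R : realType.

Hypothesis r_large :
  threshold (2 * h + 2) (k - h - 1 + (2 * h + 2)) < n - k - h - 1.

(** A loser of one of the first two comparisons loses to the extremal graph
    directly. If [M] is a star, the third comparison is made with a graph on
    the same [H], which is isomorphic to the extremal one. *)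
Lemma iso_or_rho_lt (H : sgraph (Xtype h)) (B : {set Xtype h * Ytype n k h}) :
  L_data H B -> isomorphic (L_graph (Wtype k h) H B) Gs \/
  (rho R (L_graph (Wtype k h) H B) < rho R Gs)%R.
Proof.
move=> HBdata; have [h0|h_neq0] := eqVneq h 0; first by left; apply: L_iso_h0.
have h_gt0 : 0 < h by rewrite lt0n.
have /L_dataP[_ sumM HB] := HBdata.
have sumS := extremal_sum_deg h; have tightS := extremal_tight r_gt0 hr.
have starS := extremal_star_form r_gt0 h_gt0.
have Y_gt0 : 0 < #|Ytype n k h| by rewrite card_ord.
have nbhd_le (K : sgraph (Xtype h)) (C : {set Xtype h * Ytype n k h}) :
    tight K C -> forall x, #|nbhd C x| <= 2 * h + 2.
  by move=> KC x; rewrite KC -[leqRHS]card_ord max_card.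
have rho_large : ((threshold #|Xtype h| (#|Wtype k h| + (2 * h + 2)))%:R
    <= rho R (L_graph (Wtype k h) H B))%R.
  apply: le_trans (card_Y_le_rho R (Wtype k h) Y_gt0 H B).
  by rewrite !card_ord lerBrDr natr1 ler_nat.
have rho_lt C H' :=
  rho_lt_of_data (B' := C) (H' := H') Y_gt0 rho_large (nbhd_le _ _ HB).
have [lt_s|[c cM]] := data_lt_or_star (Wtype k h) h_gt0 HB tightS sumM sumS
  (@extremal_star h).
  by right; apply: rho_lt lt_s; apply: nbhd_le tightS.
(* [B'] is the optimal boundary for the same [H]. *)
have [B' [y1 [HB' star']]] := star_form_exists h_gt0 sumM cM HB.
have iso' := star_form_iso (Wtype k h) sumM sumS HB' tightS star' starS.
have [lt_s|[y2 star]] :=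
  data_lt_or_star_form (Wtype k h) h_gt0 sumM cM HB HB' star'.
  right; apply: lt_le_trans (rho_lt _ _ (nbhd_le _ _ HB') lt_s) _.
  have V_gt0 := vertices_gt0 (Wtype k h) (Xtype h) Y_gt0.
  have /eqP E := rho_iso R V_gt0 iso'.
  rewrite le_eqVlt; apply/orP; left.
  exact: E.
by left; apply: star_form_iso sumM sumS HB tightS star starS.
Qed.

End Family.

Lemma extremal_edge_h1 h : h = 1 ->
  exists u v : Xtype h, [/\ u <> v,
    edges (gcompl (extremal_H h)) = [set [set u; v]],
    u = 0 :> nat & v = 1 :> nat].
Proof.
move=> h1; have v_lt : 1 < 2 * h + 2 by lia.
exists (center h), (Ordinal v_lt); split=> //.
apply/setP=> e; rewrite inE; apply/imsetP/eqP => [[[x y]]|->].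
  rewrite inE /= => Mxy ->; move: Mxy.
  rewrite -[compl_adj _ _ _]/(gcompl (extremal_H h) x y) extremal_M /star_adj.
  case/orP=> /andP[/eqP x0 y1].
    by congr [set _; _]; apply: val_inj => /=; lia.
  by rewrite setUC; congr [set _; _]; apply: val_inj => /=; lia.
exists (center h, Ordinal v_lt) => //; rewrite inE.
rewrite -[X in is_true X]/(gcompl (extremal_H h) (center h) (Ordinal v_lt)).
by rewrite extremal_M /star_adj /=; lia.
Qed.

Section StarShape.
Variable h : nat.

Lemma leaf_lt (i : 'I_h) : i.+1 < 2 * h + 2.
Proof. by have := ltn_ord i; lia. Qed.

Lemma isolated_lt (j : 'I_h.+1) : h + 1 + j < 2 * h + 2.
Proof. by have := ltn_ord j; lia. Qed.

Definition star_labels (u : 'I_1 + 'I_h + 'I_h.+1) : Xtype h :=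
  match u with
  | inl (inl _) => center h
  | inl (inr i) => Ordinal (leaf_lt i)
  | inr j => Ordinal (isolated_lt j)
  end.

Lemma star_labels_giso :
  giso (gunion (star h) (edgeless 'I_h.+1)) (gcompl (extremal_H h)) star_labels.
Proof.
split.
  apply: inj_card_bij; last by rewrite !card_sum !card_ord; lia.
  move=> [[i|i]|i] [[j|j]|j] /(congr1 val) /= E;
    have := ltn_ord i; have := ltn_ord j => ltj lti;
    try (by exfalso; lia); do ?congr inl; do ?congr inr;
    apply: val_inj => /=; lia.
move=> u v; rewrite extremal_M /star_adj.
case: u => [[i|i]|i]; case: v => [[j|j]|j] //=;
  have := ltn_ord i; have := ltn_ord j => ltj lti; lia.
Qed.

End StarShape.

Theorem theorem1p1 (R : realType) (k delta : nat)
    (hk : (2 <= k)%N) (hd1 : (k <= delta)%N) (hd2 : (delta <= 2 * k - 1)%N) :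
  let h := (delta - k)%N in
  exists n_int : nat, (2 * delta + 2 <= n_int)%N /\
  forall n : nat, (n_int <= n)%N ->
  exists (H : sgraph (Xtype h)) (B : {set Xtype h * Ytype n k h}),
    let Gstar := L_graph (Wtype k h) H B in
    let Mstar := gcompl H in
    let NY := N_Y (Wtype k h) H B in
    L_data H B /\
    (forall (T : finType) (G : sgraph T), L_family n k delta G ->
       (rho R G <= rho R Gstar)%R /\
       (rho R G = rho R Gstar <-> isomorphic G Gstar)) /\
    (forall (T : finType) (G : sgraph T), L_family n k delta G ->
       ((forall (T' : finType) (G' : sgraph T'), L_family n k delta G' ->
           (rho R G' <= rho R G)%R) <->
        isomorphic G Gstar)) /\
    (h = 0%N ->
       forall (T : finType) (G : sgraph T),
         L_family n k delta G <-> isomorphic G Gstar) /\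
    (h = 1%N ->
       exists (u v : Xtype h) (y1 : Ytype n k h),
         u <> v /\ edges Mstar = [set [set u; v]] /\
         NY u = [set y1] /\ NY v = [set y1]) /\
    ((2 <= h)%N ->
       exists f : 'I_1 + 'I_h + 'I_h.+1 -> Xtype h,
         giso (gunion (star h) (edgeless 'I_h.+1)) Mstar f /\
         let c := f (inl (inl ord0)) in
         let leaf (i : 'I_h) := f (inl (inr i)) in
         exists (y : 'I_h -> Ytype n k h) (i1 : 'I_h),
           injective y /\ i1 = 0%N :> nat /\
           NY c = [set y i | i : 'I_h] /\
           forall i : 'I_h, NY (leaf i) = [set y i1]).
Proof.
move=> h.
exists (2 * delta + 2 + threshold (2 * h + 2) (k - h - 1 + (2 * h + 2))
  + k + h + 2).
split=> [|n n_large]; first by lia.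
have r_large :
  threshold (2 * h + 2) (k - h - 1 + (2 * h + 2)) < n - k - h - 1 by lia.
have r_gt0 : 0 < n - k - h - 1 by lia.
have hr : h <= n - k - h - 1 by lia.
exists (extremal_H h), (extremal_B h (n - k - h - 1)) => Gstar Mstar NY.
have dataS : L_data (extremal_H h) (extremal_B h (n - k - h - 1)).
  exact: extremal_L_data.
have famS : L_family n k delta Gstar.
  exists (extremal_H h), (extremal_B h (n - k - h - 1)); split=> //.
  by exists id; split=> //; exists id.
have rho_iso_any (T T' : finType) (G : sgraph T) (G' : sgraph T') :
    isomorphic G G' -> 0 < #|T'| -> rho R G = rho R G'.
  by move=> iso T'_gt0; rewrite (rho_iso R T'_gt0 (isomorphic_sym iso)).
have L_gt0 : 0 < #|{: Wtype k h + (Xtype h + Ytype n k h)}|.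
  by apply: vertices_gt0; rewrite card_ord.
have family_cases (T : finType) (G : sgraph T) : L_family n k delta G ->
    isomorphic G Gstar \/ (rho R G < rho R Gstar)%R.
  case=> H [B [HB iso]].
  have [isoS|lt] := iso_or_rho_lt hd1 hd2 hk r_gt0 hr R r_large HB.
    by left; apply: isomorphic_trans iso isoS.
  by right; rewrite (rho_iso_any _ _ _ _ iso).
have maximal (T : finType) (G : sgraph T) : L_family n k delta G ->
    (rho R G <= rho R Gstar)%R /\
    (rho R G = rho R Gstar <-> isomorphic G Gstar).
  move=> /family_cases[iso|lt].
    by rewrite (rho_iso_any _ _ _ _ iso) //; split.
  split; first exact: ltW.
  split=> [E|/rho_iso_any ->//]; by rewrite E ltxx in lt.
split=> //; split=> //; split.
  move=> T G famG; split=> [Gmax|iso].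
    have [le_S eq_S] := maximal _ _ famG; apply/eq_S/le_anti.
    by rewrite le_S Gmax.
  by move=> T' G' /maximal[+ _]; rewrite (rho_iso_any _ _ _ _ iso).
split.
  move=> h0 T G; split=> [[H [B [HB iso]]]|iso].
    by apply: isomorphic_trans iso (L_iso_h0 _ _ _ _ _ h0 HB).
  by exists (extremal_H h), (extremal_B h (n - k - h - 1)).
split.
  move=> h1; have [u [v [uv edgesM u0 v1]]] := extremal_edge_h1 h1.
  exists u, v, (first_Y r_gt0); split=> //; split=> //.
  rewrite /NY !N_YE; split; last by rewrite extremal_nbhd_leaf // v1 h1.
  rewrite (_ : u = center h); last exact: val_inj.
  rewrite extremal_nbhd_center; apply/setP=> y; rewrite !inE -val_eqE /=; lia.
move=> h2; have h_gt0 : 0 < h by lia.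
exists (@star_labels h); split; first exact: star_labels_giso.
move=> c leaf; exists (widen_ord hr), (Ordinal h_gt0); split.
  by move=> i j /(congr1 val) /= /val_inj.
split=> //; split.
  rewrite /NY N_YE extremal_nbhd_center; apply/setP=> y; rewrite inE.
  apply/idP/imsetP => [yh|[j _ ->] /=]; last exact: ltn_ord.
  by exists (Ordinal yh) => //; apply: val_inj.
move=> i; rewrite /NY N_YE extremal_nbhd_leaf /=; last exact: ltn_ord.
by congr [set _]; apply: val_inj.
Qed.
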